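(* Let $m\le n$ (so $l=m$). Suppose Condition 1 and Condition 2 of the context hold and $f:\Omega\subset\mathbb{R}^N\to E_2$ is a sufficiently smooth function. Then any solution $u$ of the equation $$L_0\Bigl(\frac{\partial}{\partial x}\Bigr)Bu+\sum_{i=1}^q L_i\Bigl(\frac{\partial}{\partial x}\Bigr)A_iu=f(x)$$ can be represented in the form $$u(x)=B^+v(x)+(C(x),\Phi)+\sum_{i=m+1}^n\lambda_i(x)\varphi_i ,$$ where $v(x)\in E_{2\infty-k}$ satisfies the regular equation $$\Bigl[L_0\Bigl(\frac{\partial}{\partial x}\Bigr)+\sum_{i=1}^qL_i\Bigl(\frac{\partial}{\partial x}\Bigr)A_iB^+\Bigr]v=(I-Q_k)f(x)-\sum_{j=1}^q\sum_{i=m+1}^nL_j\Bigl(\frac{\partial}{\partial x}\Bigr)A_j\varphi_i\lambda_i(x),$$ and the vector function $C(x)\in\mathbb{R}^k$ is defined from the system $$L_0\Bigl(\frac{\partial}{\partial x}\Bigr)\mathcal{A}_BC+\sum_{i=1}^qL_i\Bigl(\frac{\partial}{\partial x}\Bigr)\mathcal{A}_i'C=\Bigl\langle f(x)-\sum_{j=2}^q\sum_{i=m+1}^nL_j\Bigl(\frac{\partial}{\partial x}\Bigr)A_j\varphi_i\lambda_i(x),\Psi\Bigr\rangle .$$ The (sufficiently smooth) scalar functions $\lambda_i(x)$, $i=m+1,\dots,n$, remain arbitrary: for any choice of them, any such $v$ and $C$ give a solution $u$ by the displayed formula.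
   Context: Setting. $E_1,E_2$ are real Banach spaces; $B,A_1,\dots,A_q$ are closed linear operators from $E_1$ to $E_2$ with dense domains, $D(B)\subseteq D(A_i)$. $B$ is Noetherian: its range is closed, $\dim N(B)=n<\infty$, $\dim N(B^* )=m<\infty$. Put $l=\min(m,n)$. For $i=0,\dots,q$, $L_i(\partial/\partial x)=\sum_{|\kappa|\le q_i}a^i_\kappa(x)D^\kappa$ is a scalar linear partial differential operator of order $q_i$, $q_0>q_1>\dots>q_q$, with sufficiently smooth coefficients $a^i_\kappa:\Omega\to\mathbb{R}$, $\Omega\subset\mathbb{R}^N$. Solutions are classical: $u$ takes values in $D(B)$ and $u$, $Bu$ are sufficiently smooth. An equation with leading term $L_0(\partial/\partial x)Tu$ is called regular if $T$ has a bounded inverse (here $T=I$). Condition 1 (complete Jordan sets). There are a basis $\varphi_1,\dots,\varphi_n$ of $N(B)$, a basis $\psi_1,\dots,\psi_m$ of $N(B^* )$, positive integers $p_1,\dots,p_l$, and elements $\varphi_i^{(j)}\in D(B)$, $\psi_i^{(j)}\in D(B^* )\cap D(A_1^* )$ ($i=1,\dots,l$, $j=1,\dots,p_i$) with $\varphi_i^{(1)}=\varphi_i$, $\psi_i^{(1)}=\psi_i$, $B\varphi_i^{(j+1)}=A_1\varphi_i^{(j)}$, $B^*\psi_i^{(j+1)}=A_1^*\psi_i^{(j)}$ for $1\le j\le p_i-1$, such that with $$\gamma_i^{(j)}=A_1^*\psi_i^{(p_i+1-j)},\qquad z_i^{(j)}=A_1\varphi_i^{(p_i+1-j)}$$ one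 has the biorthogonality relations $\langle\varphi_i^{(j)},\gamma_s^{(t)}\rangle=\delta_{is}\delta_{jt}$ and $\langle z_i^{(j)},\psi_s^{(t)}\rangle=\delta_{is}\delta_{jt}$. When $n>m$, moreover $\langle\varphi_i,\gamma_s^{(t)}\rangle=0$ for $i=m+1,\dots,n$, $s\le m$, and $\gamma_{m+1},\dots,\gamma_n\in E_1^*$ are functionals with $\langle\varphi_i,\gamma_s\rangle=\delta_{is}$ ($i,s=m+1,\dots,n$) and $\langle\varphi_i^{(j)},\gamma_s\rangle=0$ for $i\le m$, $s>m$. Projectors. With $k=p_1+\dots+p_l$, $$P_k=\sum_{i=1}^l\sum_{j=1}^{p_i}\langle\cdot,\gamma_i^{(j)}\rangle\varphi_i^{(j)},\qquad Q_k=\sum_{i=1}^l\sum_{j=1}^{p_i}\langle\cdot,\psi_i^{(j)}\rangle z_i^{(j)},\qquad E_{2\infty-k}=(I-Q_k)E_2 .$$ $(P_k,Q_k)$-commutability. A closed densely defined operator $A:E_1\to E_2$ $(P_k,Q_k)$-commutes if for every $u\in D(A)$ one has $P_ku\in D(A)$ and $AP_ku=Q_kAu$. Condition 2. The operators $A_2,\dots,A_q$ $(P_k,Q_k)$-commute. ($B$ and $A_1$ do so under Condition 1.) Notation. $\Phi$, $\Psi$, $Z$ are the $k$-tuples of all $\varphi_i^{(j)}$, $\psi_i^{(j)}$, $z_i^{(j)}$ ($i\le l$, $j\le p_i$), in the same order. For $C=(C_{ij})\in\mathbb{R}^k$, $(C,\Phi)=\sum_{i=1}^l\sum_{j=1}^{p_i}C_{ij}\varphi_i^{(j)}$.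 For $y\in E_2$, $\langle y,\Psi\rangle\in\mathbb{R}^k$ is the vector of all $\langle y,\psi_i^{(j)}\rangle$. The $k\times k$ matrices $\mathcal{A}_i$ ($i=1,\dots,q$) are defined by $A_i\Phi=\mathcal{A}_iZ$, prime denotes transpose, so that $\langle A_i(C,\Phi),\Psi\rangle=\mathcal{A}_i'C$; $\mathcal{A}_B$ is the symmetric $k\times k$ matrix with $B\Phi=\mathcal{A}_BZ$, so that $\langle B(C,\Phi),\Psi\rangle=\mathcal{A}_BC$. Pseudoinverse (for $m\le n$). $B^+:E_2\to E_1$ is the bounded pseudoinverse of $B$ determined by $B^+z_i^{(1)}=0$ ($i=1,\dots,m$) and, for $y\in R(B)$, $B^+y$ is the unique $w\in D(B)$ with $Bw=y$, $\langle w,\gamma_i^{(1)}\rangle=0$ ($i\le m$) and $\langle w,\gamma_i\rangle=0$ ($m<i\le n$). *)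

(* Defs.v *)
From HB Require Import structures.
From mathcomp Require Import all_boot all_order all_algebra.
From mathcomp Require Import all_classical all_reals all_analysis.

Set Implicit Arguments.
Unset Strict Implicit.
Unset Printing Implicit Defensive.

Import Order.TTheory GRing.Theory Num.Theory.
Import numFieldNormedType.Exports.

Local Open Scope classical_set_scope.
Local Open Scope ring_scope.

(* MathComp-Analysis, real scalars [R : realType].  Ordinals ['I_n] are
   0-based, so [i : 'I_n] stands for the mathematical index i+1; in particular
   the range m < i <= n is [(i : 'I_n) with m <= i].  The inner
   chain index j (from 1) and the index i of A_i (from 1) and L_i (from 0) are
   naturals without shift; values outside the relevant range are
   unconstrained. *)

Section LinearAlgebra.
Context {R : realType}.

Definition is_basis (V : lmodType R) (S : set V) (n : nat) (e : 'I_n -> V) :=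
  (forall c : 'I_n -> R, \sum_i c i *: e i = 0 -> forall i, c i = 0) /\
  S = [set \sum_i c i *: e i | c in [set: 'I_n -> R]].

Definition has_dim (V : lmodType R) (S : set V) (n : nat) :=
  exists e : 'I_n -> V, is_basis S e.

End LinearAlgebra.

Section Operators.
Context {R : realType}.

(* [clop_fun] is total, but only its restriction to [dom] is meaningful. *)
Record closed_op (E1 E2 : normedModType R) := ClosedOp {
  dom : set E1;
  clop_fun :> E1 -> E2;
  dom0 : dom 0;
  dom_lin : forall (a : R) x y, dom x -> dom y -> dom (a *: x + y);
  clop_linear : forall (a : R) x y, dom x -> dom y ->
    clop_fun (a *: x + y) = a *: clop_fun x + clop_fun y;
  dom_dense : dense dom;
  clop_closed : closed [set z : E1 * E2 | dom z.1 /\ z.2 = clop_fun z.1]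
}.

Context {E1 E2 : normedModType R}.
Implicit Types A B : closed_op E1 E2.

(* The topological dual; the pairing <x, g> is the value [g x]. *)
Definition dual (E : normedModType R) : set (E -> R^o) :=
  [set g | linear g /\ continuous g].

Definition adj_graph A (psi : E2 -> R^o) (g : E1 -> R^o) :=
  [/\ dual psi, dual g & forall x, dom A x -> psi (A x) = g x].

Definition adj_dom A : set (E2 -> R^o) :=
  [set psi | exists g, adj_graph A psi g].

(* A^* psi, determined for psi in D(A^* ) by the density of D(A). *)
Definition adj A (psi : E2 -> R^o) : E1 -> R^o := xget 0 (adj_graph A psi).

Definition kernel B : set E1 := [set x | dom B x /\ B x = 0].

Definition adj_kernel B : set (E2 -> R^o) :=
  [set psi | adj_dom B psi /\ adj B psi = 0].

Definition op_range B : set E2 := B @` dom B.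

Definition noetherian B (n m : nat) :=
  [/\ closed (op_range B), has_dim (kernel B) n & has_dim (adj_kernel B) m].

Definition commutes (P : E1 -> E1) (Q : E2 -> E2) A :=
  forall u, dom A u -> dom A (P u) /\ A (P u) = Q (A u).

End Operators.

Section Jordan.
Context {R : realType} {E1 E2 : normedModType R}.

Record jordan_data (n m : nat) := JordanData {
  jlen : 'I_(minn m n) -> nat;                 (* p_i *)
  phi_bas : 'I_n -> E1;                        (* phi_i *)
  psi_bas : 'I_m -> E2 -> R^o;                 (* psi_i *)
  phi : 'I_(minn m n) -> nat -> E1;            (* phi_i^(j), 1 <= j <= p_i *)
  psi : 'I_(minn m n) -> nat -> E2 -> R^o;     (* psi_i^(j), 1 <= j <= p_i *)
  gam_bas : 'I_n -> E1 -> R^o                  (* gamma_i, only m < i <= n *)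
}.

Variables (n m : nat) (B A1 : closed_op E1 E2) (J : jordan_data n m).

Definition gam (i : 'I_(minn m n)) (j : nat) : E1 -> R^o :=
  adj A1 (psi J i ((jlen J i).+1 - j)).

Definition zet (i : 'I_(minn m n)) (j : nat) : E2 :=
  A1 (phi J i ((jlen J i).+1 - j)).

Record complete_jordan : Prop := CompleteJordan {
  cj_phi_basis : is_basis (kernel B) (phi_bas J);
  cj_psi_basis : is_basis (adj_kernel B) (psi_bas J);
  cj_len : forall i, (0 < jlen J i)%N;
  cj_phi_dom : forall i j, (1 <= j <= jlen J i)%N -> dom B (phi J i j);
  cj_psi_dom : forall i j, (1 <= j <= jlen J i)%N ->
    adj_dom B (psi J i j) /\ adj_dom A1 (psi J i j);
  cj_phi1 : forall i, phi J i 1 = phi_bas J (widen_ord (geq_minr m n) i);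
  cj_psi1 : forall i, psi J i 1 = psi_bas J (widen_ord (geq_minl m n) i);
  cj_phi_chain : forall i j, (1 <= j < jlen J i)%N ->
    B (phi J i j.+1) = A1 (phi J i j);
  cj_psi_chain : forall i j, (1 <= j < jlen J i)%N ->
    adj B (psi J i j.+1) = adj A1 (psi J i j);
  cj_biorth_phi : forall i j s t,
    (1 <= j <= jlen J i)%N -> (1 <= t <= jlen J s)%N ->
    gam s t (phi J i j) = ((i == s) && (j == t))%:R;
  cj_biorth_psi : forall i j s t,
    (1 <= j <= jlen J i)%N -> (1 <= t <= jlen J s)%N ->
    psi J s t (zet i j) = ((i == s) && (j == t))%:R;
  cj_extra_gam : (m < n)%N -> forall (i : 'I_n) s t,
    (m <= i)%N -> (1 <= t <= jlen J s)%N -> gam s t (phi_bas J i) = 0;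
  cj_extra_dual : (m < n)%N -> forall s : 'I_n, (m <= s)%N ->
    dual (gam_bas J s);
  cj_extra_biorth : (m < n)%N -> forall i s : 'I_n, (m <= i)%N -> (m <= s)%N ->
    gam_bas J s (phi_bas J i) = (i == s)%:R;
  cj_extra_phi : (m < n)%N -> forall i j (s : 'I_n),
    (1 <= j <= jlen J i)%N -> (m <= s)%N -> gam_bas J s (phi J i j) = 0
}.

Definition Pk (u : E1) : E1 :=
  \sum_i \sum_(1 <= j < (jlen J i).+1) gam i j u *: phi J i j.

Definition Qk (y : E2) : E2 :=
  \sum_i \sum_(1 <= j < (jlen J i).+1) psi J i j y *: zet i j.

(* The subspace (I - Q_k) E_2. *)
Definition coQk_range : set E2 := range (fun y => y - Qk y).

(* The k-tuples Phi, Psi, Z, enumerated lexicographically in (i, j). *)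
Definition jdim : nat := (\sum_i jlen J i)%N.

Definition Phi (s : 'I_jdim) : E1 :=
  phi J (tagnat.sig1 s) (tagnat.sig2 s).+1.

Definition Psi (s : 'I_jdim) : E2 -> R^o :=
  psi J (tagnat.sig1 s) (tagnat.sig2 s).+1.

Definition Zet (s : 'I_jdim) : E2 :=
  zet (tagnat.sig1 s) (tagnat.sig2 s).+1.

Definition pairPhi (C : 'cV[R]_jdim) : E1 := \sum_s C s 0 *: Phi s.

Definition pairPsi (y : E2) : 'cV[R]_jdim := \col_s Psi s y.

(* [M] is the matrix defined by A Phi = M Z. *)
Definition represents (A : closed_op E1 E2) (M : 'M[R]_jdim) :=
  forall s, A (Phi s) = \sum_t M s t *: Zet t.

Definition is_pseudoinverse (Bp : {linear E2 -> E1}) :=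
  [/\ continuous Bp,
      forall i, Bp (zet i 1) = 0 &
      forall y, op_range B y ->
        [/\ dom B (Bp y), B (Bp y) = y,
            forall i, gam i 1 (Bp y) = 0 &
            forall s : 'I_n, (m <= s)%N -> gam_bas J s (Bp y) = 0]].

End Jordan.

Arguments jordan_data {R} E1 E2 n m.

Section DiffOps.
Context {R : realType} {N : nat}.

Section Functions.
Context {E : normedModType R}.
Implicit Types (u : 'rV[R]_N -> E) (Om : set 'rV[R]_N).

Definition partial (j : 'I_N) u : 'rV[R]_N -> E :=
  fun x => 'D_(delta_mx 0 j) u x.

Definition Dmulti (k : 'I_N -> nat) u : 'rV[R]_N -> E :=
  foldr (fun j g => iter (k j) (partial j) g) u (enum 'I_N).

(* The class C^r on an open set [Om]. *)
Fixpoint Cr (r : nat) Om u : Prop :=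
  (forall x, Om x -> {for x, continuous u}) /\
  (if r is r'.+1 then
     forall j, (forall x, Om x -> derivable u x (delta_mx 0 j)) /\
               Cr r' Om (partial j u)
   else True).

End Functions.

(* Scalar operators sum_(|k| <= pdo_ord) pdo_coef k (x) D^k. *)
Record pdo := Pdo {
  pdo_ord : nat;
  pdo_coef : ('I_N -> nat) -> 'rV[R]_N -> R^o
}.

Definition pdo_app (L : pdo) (E : normedModType R) (u : 'rV[R]_N -> E)
    (x : 'rV[R]_N) : E :=
  \sum_(k : {ffun 'I_N -> 'I_(pdo_ord L).+1} | (\sum_j k j <= pdo_ord L)%N)
     pdo_coef L (fun j => k j : nat) x *: Dmulti (fun j => k j : nat) u x.

Definition pdo_smooth (r : nat) (Om : set 'rV[R]_N) (L : pdo) :=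
  forall k : 'I_N -> nat, (\sum_j k j <= pdo_ord L)%N -> Cr r Om (pdo_coef L k).

End DiffOps.

Arguments pdo R N : clear implicits.

Section Equations.
Context {R : realType} {E1 E2 : normedModType R} {N : nat}.
Variables (r : nat) (Om : set 'rV[R]_N).
Variables (q : nat) (B : closed_op E1 E2) (A : nat -> closed_op E1 E2).
Variables (L : nat -> pdo R N) (f : 'rV[R]_N -> E2).

(* Classical solutions of class C^r of  L_0 B u + sum_i L_i A_i u = f. *)
Definition is_solution (u : 'rV[R]_N -> E1) :=
  [/\ forall x, Om x -> dom B (u x),
      Cr r Om u,
      Cr r Om (fun x => B (u x)) &
      forall x, Om x ->
        pdo_app (L 0%N) (fun y => B (u y)) x
        + \sum_(1 <= i < q.+1) pdo_app (L i) (fun y => A i (u y)) x = f x].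

Variables (n m : nat) (J : jordan_data E1 E2 n m).

Definition regular_eq (Bp : E2 -> E1) (lam : 'I_n -> 'rV[R]_N -> R^o)
    (v : 'rV[R]_N -> E2) :=
  forall x, Om x ->
    pdo_app (L 0%N) v x
    + \sum_(1 <= i < q.+1) pdo_app (L i) (fun y => A i (Bp (v y))) x
    = (f x - Qk (A 1%N) J (f x))
      - \sum_(1 <= j < q.+1) \sum_(i < n | (m <= i)%N)
          pdo_app (L j) (fun y => lam i y *: A j (phi_bas J i)) x.

Definition coef_system (MB : 'M[R]_(jdim J)) (M : nat -> 'M[R]_(jdim J))
    (lam : 'I_n -> 'rV[R]_N -> R^o) (C : 'rV[R]_N -> 'cV[R]_(jdim J)) :=
  forall x, Om x ->
    pdo_app (L 0%N) (fun y => MB *m C y) x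
    + \sum_(1 <= i < q.+1) pdo_app (L i) (fun y => (M i)^T *m C y) x
    = pairPsi J
        (f x - \sum_(2 <= j < q.+1) \sum_(i < n | (m <= i)%N)
                 pdo_app (L j) (fun y => lam i y *: A j (phi_bas J i)) x).

End Equations.

(* Main.v *)
Require Import Defs.
From HB Require Import structures.
From mathcomp Require Import all_boot all_order all_algebra.
From mathcomp Require Import all_classical all_reals all_analysis.
From mathcomp Require Import lra zify.

Set Implicit Arguments.
Unset Strict Implicit.
Unset Printing Implicit Defensive.

Import Order.TTheory GRing.Theory Num.Theory.
Import numFieldNormedType.Exports.

Local Open Scope classical_set_scope.
Local Open Scope ring_scope.

(** The pair of projectors P = Pk and Q = Qk splits the equation.

    B and all the A_i intertwine P and Q, so the equation falls apart into its
    components in the range of Q, which is spanned by the k vectors Zet, and in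
    the range of I - Q.  Write u = w + P u + sum lam_i phi_i with
    lam_i = <u, gamma_i> for i > m and v = B u - Q B u.  Then w lies in D(B),
    B w = v, and w is annihilated by the functionals gamma_i^(1) (i <= m) and
    gamma_i (i > m); these conditions characterize B^+ v because the only
    element of N(B) that they all annihilate is 0
    ([pseudoinverse_decomposition]).  With C the vector of coefficients of P u
    in the basis Phi, this is the asserted representation.

    Conversely, let u be assembled from v, C and lam.  The functionals Psi
    annihilate v, A_i B^+ v and A_i phi_j (j > m), and they are dual to Zet;
    hence the Psi-coordinates of the equation form the system for C, and what
    remains is the regular equation for v.  [equation_splits] states this
    equivalence at each point, and both halves of the theorem follow from it.

    Two facts of functional analysis enter.
    - R(B) is the common null space of the psi_i^(1).  As R(B) is closed, a
      point outside it is separated from it by a bounded functional that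
      vanishes on R(B), that is, by an element of the kernel of the adjoint of
      B, which is spanned by the psi_i^(1).  This is the Hahn-Banach theorem
      ([separate_closed_subspace]).  It gives B B^+ v = v, and it shows that
      B^+ maps the whole of E_2 into D(B).
    - A_i B^+ is therefore defined on the whole of E_2, and it is bounded by
      the closed graph theorem ([closed_graph]).  So A_i B^+ v is as smooth as
      v, and the differential operators L_i act term by term on the
      decomposition of A_i u.  Without this regularity the derivatives of the
      separate terms could fail to exist. *)

(** * Separation of a point from a closed subspace *)
Section HahnBanach.
Context {R : realType}.

Definition sublinear (V : lmodType R) (p : V -> R) :=
  (forall x y, p (x + y) <= p x + p y) /\
  (forall t x, 0 <= t -> p (t *: x) <= t * p x).

Lemma sublinear0 (V : lmodType R) (p : V -> R) : sublinear p -> p 0 = 0.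
Proof.
move=> [pD pZ]; apply/eqP; rewrite eq_le; apply/andP; split.
  by have := pZ 0 0 (lexx _); rewrite scale0r mul0r.
by have := pD 0 0; rewrite addr0; lra.
Qed.

Lemma sublinear_ge (V : lmodType R) (p : V -> R) x :
  sublinear p -> - p (- x) <= p x.
Proof.
move=> sp; have := sp.1 x (- x); rewrite subrr (sublinear0 sp); lra.
Qed.

Lemma sublinear_odd_linear (V : lmodType R) (p : V -> R) :
  sublinear p -> (forall x, p (- x) <= - p x) -> linear (p : V -> R^o).
Proof.
move=> sp podd.
have [pD pZ] := sp.
have pN x : p (- x) = - p x.
  by apply/eqP; rewrite eq_le podd lerNl sublinear_ge.
have pA x y : p (x + y) = p x + p y.
  apply/eqP; rewrite eq_le pD /=.
  by have := pD (x + y) (- y); rewrite addrK pN; lra.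
have pP t x : 0 <= t -> p (t *: x) = t * p x.
  move=> t0; apply/eqP; rewrite eq_le pZ//=.
  by have := pZ t (- x) t0; rewrite scalerN !pN; lra.
move=> a x y; rewrite pA; congr (_ + _); rewrite -[RHS]/(a * p x).
have [a0|a0] := leP 0 a; first exact: pP.
by rewrite -[a *: x]opprK -scaleNr pN pP ?oppr_ge0 1?ltW// mulNr opprK.
Qed.

(** A sublinear p that dominates s at z for each (z, s) in a convex cone K can
    be lowered, without losing sublinearity, so that its value at - z becomes
    at most - s.  The ray {(t z, t p(z)) | t >= 0} makes a minimal functional
    odd at z; the cone {(t y - z, t d) | t >= 0, z in F} forces a functional to
    separate y from F. *)
Section InfOverCone.
Context {V : lmodType R} (p : V -> R) (K : V -> R -> Prop).
Hypotheses (sp : sublinear p) (K0 : K 0 0)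
  (KD : forall z s w t, K z s -> K w t -> K (z + w) (s + t))
  (KZ : forall a z s, 0 <= a -> K z s -> K (a *: z) (a * s))
  (Kp : forall z s, K z s -> s <= p z).

Definition cone_inf (x : V) : R :=
  inf [set r | exists z s, K z s /\ r = p (x + z) - s].

Let cone_lb x : lbound [set r | exists z s, K z s /\ r = p (x + z) - s]
  (- p (- x)).
Proof.
move=> _ [z [s [Kzs ->]]].
by have := sp.1 (x + z) (- x); rewrite addrAC subrr add0r; have := Kp Kzs; lra.
Qed.

Lemma cone_inf_le x z s : K z s -> cone_inf x <= p (x + z) - s.
Proof.
by move=> Kzs; apply: ge_inf; [exists (- p (- x)); exact: cone_lb|exists z, s].
Qed.

Lemma le_cone_inf x b :
  (forall z s, K z s -> b <= p (x + z) - s) -> b <= cone_inf x.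
Proof.
move=> H; apply: lb_le_inf; first by exists (p (x + 0) - 0), 0, 0.
by move=> _ [z [s [Kzs ->]]]; exact: H.
Qed.

Lemma cone_inf_sublinear : sublinear cone_inf.
Proof.
split=> [x y|t x t0].
  rewrite -lerBlDr; apply: le_cone_inf => z s Kzs.
  rewrite lerBlDl -lerBlDr; apply: le_cone_inf => w u Kwu.
  have := cone_inf_le (x + y) (KD Kzs Kwu).
  by rewrite addrACA; have := sp.1 (x + z) (y + w); lra.
move: t0; rewrite le_eqVlt => /predU1P[<-|t0].
  rewrite scale0r mul0r; have := cone_inf_le 0 K0.
  by rewrite addr0 (sublinear0 sp); lra.
rewrite -ler_pdivrMl//; apply: le_cone_inf => z s Kzs.
rewrite ler_pdivrMl//; have := cone_inf_le (t *: x) (KZ (ltW t0) Kzs).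
by rewrite -scalerDr; have := sp.2 t (x + z) (ltW t0); lra.
Qed.

Lemma cone_inf_base x : cone_inf x <= p x.
Proof. by have := cone_inf_le x K0; rewrite addr0 subr0. Qed.

Lemma cone_inf_opp z s : K z s -> cone_inf (- z) <= - s.
Proof.
by move=> /(cone_inf_le (- z)); rewrite addNr (sublinear0 sp) sub0r.
Qed.

End InfOverCone.

(** Only comparability makes the infimum subadditive: the smaller of the two
    functions used at x and at y serves for x + y. *)
Lemma sublinear_inf_chain (V : lmodType R) (p : V -> R) (C : set (V -> R)) :
  C !=set0 -> (forall f, C f -> sublinear f /\ forall x, f x <= p x) ->
  (forall f g, C f -> C g ->
     (forall x, f x <= g x) \/ (forall x, g x <= f x)) ->
  exists g, [/\ sublinear g, forall x, g x <= p x &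
                forall f, C f -> forall x, g x <= f x].
Proof.
move=> [f0 Cf0] CP Ctot; pose S x := [set f x | f in C]; pose g x := inf (S x).
have Slb x : has_lbound (S x).
  exists (- p (- x)) => _ [f Cf <-].
  have [sf fp] := CP _ Cf.
  by have := sublinear_ge x sf; have := fp (- x); lra.
have gle f x : C f -> g x <= f x by move=> Cf; apply: ge_inf => //; exists f.
have leg x b : (forall f, C f -> b <= f x) -> b <= g x.
  move=> H; apply: lb_le_inf; first by exists (f0 x), f0.
  by move=> _ [f Cf <-]; exact: H.
exists g; split; last by move=> f Cf x; exact: gle.
  split=> [x y|t x t0].
    rewrite -lerBlDr; apply: (leg) => f Cf; rewrite lerBlDl -lerBlDr.
    apply: (leg) => h Ch.
    have [fh|hf] := Ctot _ _ Cf Ch.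
      have := gle f (x + y) Cf; have := (CP _ Cf).1.1 x y; have := fh y; lra.
    have := gle h (x + y) Ch; have := (CP _ Ch).1.1 x y; have := hf x; lra.
  move: t0; rewrite le_eqVlt => /predU1P[<-|t0].
    rewrite scale0r mul0r (le_trans (gle f0 0 Cf0))//.
    by rewrite (sublinear0 (CP _ Cf0).1).
  rewrite -ler_pdivrMl//; apply: (leg) => f Cf; rewrite ler_pdivrMl//.
  by rewrite (le_trans (gle f _ Cf))// (CP _ Cf).1.2 ?ltW.
by move=> x; rewrite (le_trans (gle f0 x Cf0))// (CP _ Cf0).2.
Qed.

(** Hahn-Banach, without extending functionals from subspaces: Zorn's lemma
    gives a minimal sublinear functional below p, and lowering it along a ray
    cannot change it, which says that it is odd, hence linear. *)
Theorem linear_below_sublinear (V : lmodType R) (p : V -> R) :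
  sublinear p ->
  exists g : V -> R, linear (g : V -> R^o) /\ forall x, g x <= p x.
Proof.
move=> sp; pose T := {f : V -> R | sublinear f /\ forall x, f x <= p x}.
pose below (f g : T) := `[< forall x, sval g x <= sval f x >].
have [|f g h /asboolP fg /asboolP gh|[f sf] [g sg] /asboolP fg /asboolP gf
    |C Ctot|] := @Zorn T below.
- by move=> f; apply/asboolP.
- by apply/asboolP => x; exact: le_trans (gh x) (fg x).
- by apply: eq_exist; apply/funext => x; apply/le_anti; rewrite fg gf.
- have [->|/set0P[f0 Cf0]] := eqVneq C set0.
    by exists (exist _ p (conj sp (fun x => lexx _))).
  have [|_ [f Cf <-]|_ _ [f Cf <-] [h Ch <-]|g [sg gp gC]] :=
      @sublinear_inf_chain V p [set sval f | f in C].
  + by exists (sval f0), f0.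
  + by case: f {Cf}.
  + have [/asboolP|/asboolP] := Ctot _ _ Cf Ch; [by right|by left].
  + exists (exist _ g (conj sg gp)) => f Cf; apply/asboolP => x /=.
    by apply: gC; exists f.
- move=> [g [sg gp]] gmin; exists g; split=> //.
  apply: sublinear_odd_linear => // z.
  pose K (w : V) (s : R) := exists t : R, [/\ 0 <= t, w = t *: z & s = t * g z].
  have K0 : K 0 0 by exists 0; rewrite scale0r mul0r.
  have KD w s v u : K w s -> K v u -> K (w + v) (s + u).
    move=> [t [t0 -> ->]] [t' [t'0 -> ->]].
    by exists (t + t'); rewrite scalerDl mulrDl addr_ge0.
  have KZ a w s : 0 <= a -> K w s -> K (a *: w) (a * s).
    move=> a0 [t [t0 -> ->]].
    by exists (a * t); rewrite scalerA mulrA mulr_ge0.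
  have Kg w s : K w s -> s <= g w.
    move=> [t [t0 -> ->]].
    move: t0; rewrite le_eqVlt => /predU1P[<-|t0].
      by rewrite scale0r mul0r (sublinear0 sg).
    rewrite -ler_pdivlMl//.
    by rewrite -[X in g X <= _](scalerK (lt0r_neq0 t0)) sg.2// invr_ge0 ltW.
  have Kz : K z (g z) by exists 1; rewrite scale1r mul1r.
  have sh := cone_inf_sublinear sg K0 KD KZ Kg.
  have hg := cone_inf_base sg K0 Kg.
  have hp x : cone_inf g K x <= p x := le_trans (hg x) (gp x).
  have := gmin (exist _ (cone_inf g K) (conj sh hp)).
  move=> /(_ (asboolT hg)) [gE].
  by rewrite -[X in X (- z)]gE; exact: (cone_inf_opp sg Kg Kz).
Qed.

(** The norm dominates t d at t y - z for t >= 0, z in F and d the radius of a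
    ball around y that misses F.  A linear functional below the norm lowered
    along this cone is nonpositive on F, so zero there, and is at most - d
    at - y. *)
Theorem separate_closed_subspace (E : normedModType R) (F : set E) (y : E) :
  F 0 -> (forall a x z, F x -> F z -> F (a *: x + z)) -> closed F -> ~ F y ->
  exists psi : E -> R^o, [/\ dual psi, forall x, F x -> psi x = 0 & psi y != 0].
Proof.
move=> F0 Flin Fcl Fy.
have [d d0 Fd] : exists2 d : R, 0 < d & forall z, F z -> d <= `|y - z|.
  have : nbhs y (~` F).
    by apply: open_nbhs_nbhs; split => //; exact: closed_openC.
  move=> /nbhs_normP[d /= d0 sub]; exists d => // z Fz.
  by rewrite leNgt; apply/negP => /sub.
pose K (w : E) (s : R) :=
  exists (t : R) z, [/\ 0 <= t, F z, w = t *: y - z & s = t * d].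
have K0 : K 0 0 by exists 0, 0; rewrite scale0r mul0r subr0.
have KD w s v u : K w s -> K v u -> K (w + v) (s + u).
  move=> [t [z [t0 Fz -> ->]]] [t' [z' [t'0 Fz' -> ->]]].
  exists (t + t'), (z + z').
  rewrite scalerDl mulrDl addr_ge0 ?opprD 1?addrACA//.
  by split=> //; rewrite -[z]scale1r; apply: (Flin).
have KZ b w s : 0 <= b -> K w s -> K (b *: w) (b * s).
  move=> b0 [t [z [t0 Fz -> ->]]].
  exists (b * t), (b *: z); rewrite scalerBr scalerA mulrA mulr_ge0//.
  by split=> //; rewrite -[_ *: _]addr0; apply: (Flin).
pose p (x : E) : R := `|x|.
have sp : sublinear p.
  by split=> [x z|t x t0]; [exact: ler_normD|rewrite /p normrZ ger0_norm].
have Kp w s : K w s -> s <= p w.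
  move=> [t [z [t0 Fz -> ->]]]; rewrite /p.
  move: t0; rewrite le_eqVlt => /predU1P[<-|t0].
    by rewrite scale0r mul0r.
  rewrite -[z](scalerKV (lt0r_neq0 t0)) -scalerBr normrZ gtr0_norm// ler_pM2l//.
  by apply: Fd; rewrite -[_ *: _]addr0; apply: (Flin).
have [g [glin gK]] :=
  linear_below_sublinear (cone_inf_sublinear sp K0 KD KZ Kp).
have gp x : g x <= `|x| := le_trans (gK x) (cone_inf_base sp K0 Kp x).
pose G : {linear E -> R^o} := HB.pack g (GRing.isLinear.Build _ _ _ _ _ glin).
have gN x : g (- x) = - g x by exact: (linearN G).
exists g; split.
- split=> //; apply: (@bounded_linear_continuous _ _ _ G).
  apply/linear_boundedP; near=> r => x.
  apply: (@le_trans _ _ `|x|).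
    by rewrite ler_norml gp andbT lerNl -gN (le_trans (gp _))// normrN.
  by rewrite ler_peMl//; near: r; exact: nbhs_pinfty_ge.
- move=> x Fx.
  have g0 z : F z -> g z <= 0.
    move=> Fz; apply: le_trans (gK z) _.
    have Kz : K (- z) 0 by exists 0, z; rewrite scale0r mul0r sub0r.
    by have := cone_inf_opp sp Kp Kz; rewrite opprK oppr0.
  apply/eqP; rewrite eq_le g0//= -oppr_le0 -gN g0//.
  by rewrite -scaleN1r -[_ *: _]addr0; apply: (Flin).
- have Ky : K y d by exists 1, 0; rewrite scale1r mul1r subr0.
  have := le_trans (gK (- y)) (cone_inf_opp sp Kp Ky).
  by rewrite gN lerN2 => dg; rewrite gt_eqF// (lt_le_trans d0).
Unshelve. all: by end_near. Qed.

End HahnBanach.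

(** * The closed graph theorem *)
Section ClosedGraph.
Context {R : realType}.

Lemma halving_steps_cvg (F : completeNormedModType R) (W : nat -> F) (c : R) :
  (forall k, `|W k - W k.+1| <= c * 2^-1 ^+ k) ->
  exists2 l, W @ \oo --> l & `|W 0 - l| <= c * 2.
Proof.
move=> Wc; have c0 : 0 <= c.
  by have /(le_trans (normr_ge0 _)) := Wc 0; rewrite expr0 mulr1.
have h0 k : 0 < 2^-1 ^+ k :> R by rewrite exprn_gt0.
have tail k i : `|W k - W (k + i)%N| <= c * 2 * (2^-1 ^+ k - 2^-1 ^+ (k + i)).
  elim: i => [|i IH]; first by rewrite addn0 !subrr normr0 mulr0.
  have -> : W k - W (k + i.+1)%N =
      (W k - W (k + i)%N) + (W (k + i)%N - W (k + i).+1).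
    by rewrite addnS addrA subrK.
  apply: le_trans (ler_normD _ _) _; apply: le_trans (lerD IH (Wc _)) _.
  by rewrite addnS exprS; lra.
have {}tail k j : (k <= j)%N -> `|W k - W j| <= c * 2 * 2^-1 ^+ k.
  move=> /subnKC <-; apply: le_trans (tail _ _) _.
  by rewrite ler_wpM2l ?mulr_ge0// lerBlDr lerDl (ltW (h0 _)).
have : cauchy (W @ \oo).
  apply: cauchy_exP => e e0.
  have : (fun k => c * 2 * 2^-1 ^+ k) @ \oo --> (0 : R).
    by apply: cvg_geometric; rewrite ger0_norm// invf_lt1// ltr1n.
  move=> /cvgrPdist_lt/(_ e e0)[k _ /(_ k (leqnn k))].
  rewrite /= sub0r normrN ger0_norm ?mulr_ge0 ?(ltW (h0 k))// => ke.
  exists (W k); exists k => //= j kj.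
  by rewrite -ball_normE /ball_/= (le_lt_trans (tail _ _ kj)).
move=> /cauchy_cvg/cvg_ex[l Wl]; exists l => //.
have Wl' : (fun k => `|W 0 - W k|) @ \oo --> `|W 0 - l|.
  by apply: cvg_norm; apply: cvgB => //; exact: cvg_cst.
rewrite -(cvg_lim (@Rhausdorff R) Wl'); apply: limr_le.
  by apply/cvg_ex; exists `|W 0 - l|.
by apply: nearW => k /=; have := tail 0 k (leq0n _); rewrite expr0 mulr1.
Qed.

(** By Baire, some set {x | |T x| <= n} is dense in a ball, hence, by convexity
    and symmetry, in a ball around 0.  Subtracting approximations at scale
    2^-k, every small x gives remainders X k -> 0 whose images T (X k)
    converge; the limit is 0 because the graph is closed, and the sum of the
    steps bounds |T x|. *)
Theorem closed_graph (E F : completeNormedModType R) (T : {linear E -> F}) :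
  closed [set z : E * F | z.2 = T z.1] -> continuous T.
Proof.
move=> Tcl; pose S n := [set x | `|T x| <= n%:R].
have [n [x0 [r r0 ball_cl]]] : exists n x0, exists2 r : R, 0 < r &
    forall x, `|x0 - x| < r -> closure (S n) x.
  have [n nd] : exists n, ~ dense (~` closure (S n)).
    apply: contrapT => /forallNP H.
    have /(_ setT)[||x [_ Ox]] : dense (\bigcap_n ~` closure (S n)).
    - apply: Baire => n; split; last exact: contrapT (H n).
      by apply: closed_openC; exact: closed_closure.
    - by exists 0.
    - exact: openT.
    - apply: (Ox (Num.truncn `|T x|).+1 Logic.I); apply: subset_closure.
      by rewrite /S/= ltW// truncnS_gt.
  have [U [[x0 /open_nbhs_nbhs/nbhs_normP[r /= r0 rU]] US]] := denseNE nd.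
  exists n, x0, r => // x /rU Ux; apply: contrapT => Sx.
  by have : (U `&` ~` closure (S n)) x by []; rewrite US.
have near_cl x e : closure (S n) x -> 0 < e ->
    exists2 y, `|x - y| < e & `|T y| <= n%:R.
  move=> + e0 => /(_ _ (nbhsx_ballx x e e0))[y [/= Sy]].
  by rewrite -ball_normE; exists y.
(* Half the difference of approximations of x0 + x and of x0 - x. *)
have approx x e : `|x| < r -> 0 < e ->
    exists2 y, `|x - y| < e & `|T y| <= n%:R.
  move=> xr e0.
  have [|a xa Ta] := near_cl (x0 + x) e _ e0.
    by apply: ball_cl; rewrite opprD addrA subrr sub0r normrN.
  have [|b xb Tb] := near_cl (x0 - x) e _ e0.
    by apply: ball_cl; rewrite opprB addrC subrK.
  have T2 : `|2^-1 : R| = 2^-1 by rewrite ger0_norm.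
  exists (2^-1 *: (a - b)).
    have -> : x - 2^-1 *: (a - b) =
        2^-1 *: ((x0 + x - a) - (x0 - x - b)).
      have {1}-> : x = 2^-1 *: (x + x).
        by rewrite -mulr2n -[x *+ 2]scaler_nat scalerA mulVf// scale1r.
      rewrite -scalerBr; congr (_ *: _).
      by rewrite !opprD !opprK [RHS]addrACA [x0 + x + _]addrACA subrr add0r.
    rewrite normrZ T2; have := ler_normB (x0 + x - a) (x0 - x - b); lra.
  rewrite linearZ linearB/= normrZ T2; have := ler_normB (T a) (T b); lra.
have step x c : 0 < c -> `|x| < c * r ->
    exists2 y, `|x - y| < c * 2^-1 * r & `|T y| <= c * n%:R.
  move=> c0 xr.
  have [||y xy Ty] := approx (c^-1 *: x) (2^-1 * r).
  - by rewrite normrZ gtr0_norm ?invr_gt0// ltr_pdivrMl.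
  - by rewrite mulr_gt0.
  exists (c *: y); last by rewrite linearZ/= normrZ gtr0_norm// ler_pM2l.
  rewrite -[x](scalerKV (lt0r_neq0 c0)) -scalerBr normrZ gtr0_norm//.
  by rewrite -mulrA ltr_pM2l.
have bnd x : `|x| < r -> `|T x| <= n%:R * 2.
  move=> xr.
  have /choice[g gP] : forall p : E * nat, exists y,
      `|p.1| < 2^-1 ^+ p.2 * r ->
      `|p.1 - y| < 2^-1 ^+ p.2.+1 * r /\ `|T y| <= n%:R * 2^-1 ^+ p.2.
    move=> [y k] /=; have [yr|yr] := boolP (`|y| < 2^-1 ^+ k * r); last first.
      by exists 0.
    have [|z yz Tz] := step _ _ _ yr; first by rewrite exprn_gt0.
    by exists z => _; rewrite exprSr [n%:R * _]mulrC.
  pose X := fix X k := if k is k'.+1 then X k' - g (X k', k') else x.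
  have XP k : `|X k| < 2^-1 ^+ k * r.
    elim: k => [|k IH]; first by rewrite expr0 mul1r.
    by have [] := gP (X k, k) IH.
  have [k|w Ww W0] := @halving_steps_cvg F (T \o X) n%:R.
    by rewrite /= -linearB opprB addrC subrK; exact: (gP (X k, k) (XP k)).2.
  have X0 : X @ \oo --> 0.
    apply/cvgrPdist_lt => e e0.
    have : (fun k => r * 2^-1 ^+ k) @ \oo --> (0 : R).
      by apply: cvg_geometric; rewrite ger0_norm// invf_lt1// ltr1n.
    move=> /cvgrPdist_lt/(_ e e0); apply: filterS => k /=.
    rewrite !sub0r !normrN; apply: le_lt_trans.
    by rewrite (le_trans (ltW (XP k)))// mulrC ler_norm.
  have : [set z : E * F | z.2 = T z.1] (0, w).
    apply: (@closed_cvg _ _ \oo _ (fun k => (X k, T (X k)))) => //.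
    - exact: nearW.
    - exact: cvg_pair.
  by rewrite /= linear0 => w0; move: W0; rewrite w0 subr0.
apply: bounded_linear_continuous; apply/ex_bound; exists (n%:R * 2).
by apply/nbhs_norm0P; exists r.
Qed.

End ClosedGraph.

(** * Continuous linear maps *)
Section ContinuousLinear.
Context {R : realType}.

(** A predicate on plain functions, so that it applies to the members of
    [dual] and to operators given by formulas. *)
Definition clinear (E F : normedModType R) (T : E -> F) :=
  linear T /\ continuous T.

Section Theory.
Variables (E F : normedModType R) (T : E -> F).
Hypothesis Tlin : clinear T.

Let TL : {linear E -> F} := HB.pack T (GRing.isLinear.Build _ _ _ _ T Tlin.1).

Lemma clinear0 : T 0 = 0. Proof. exact: (linear0 TL). Qed.
Lemma clinearD x y : T (x + y) = T x + T y. Proof. exact: (linearD TL). Qed.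
Lemma clinearB x y : T (x - y) = T x - T y. Proof. exact: (linearB TL). Qed.
Lemma clinearZ a x : T (a *: x) = a *: T x. Proof. exact: (linearZ_LR TL). Qed.
Lemma clinear_sum I (s : seq I) (P : pred I) (f : I -> E) :
  T (\sum_(i <- s | P i) f i) = \sum_(i <- s | P i) T (f i).
Proof. exact: (linear_sum TL). Qed.

End Theory.

Lemma clinear_of (E F : normedModType R) (T : {linear E -> F}) :
  continuous T -> clinear T.
Proof. by split=> // a x y; rewrite linearP. Qed.

Lemma clinear_id (E : normedModType R) : clinear (@idfun E).
Proof. by split=> // x; exact: cvg_id. Qed.

Lemma clinear_cst0 (E F : normedModType R) : clinear (fun _ : E => 0 : F).
Proof.
by split=> [a x y|x]; [rewrite scaler0 addr0|exact: cvg_cst].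
Qed.

Lemma clinear_comp (E F G : normedModType R) (S : F -> G) (T : E -> F) :
  clinear S -> clinear T -> clinear (fun x => S (T x)).
Proof.
move=> Sl Tl; split=> [a x y|x]; first by rewrite Tl.1 Sl.1.
by apply: continuous_comp; [exact: Tl.2|exact: Sl.2].
Qed.

Lemma clinear_add (E F : normedModType R) (S T : E -> F) :
  clinear S -> clinear T -> clinear (fun x => S x + T x).
Proof.
move=> Sl Tl; split=> [a x y|x].
  by rewrite Tl.1 Sl.1 scalerDr addrACA.
by apply: cvgD; [exact: Sl.2|exact: Tl.2].
Qed.

Lemma clinear_scale (E F : normedModType R) (a : R) (T : E -> F) :
  clinear T -> clinear (fun x => a *: T x).
Proof.
move=> Tl; split=> [b x y|x].
  by rewrite Tl.1 scalerDr !scalerA mulrC.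
by apply: cvgZr; exact: Tl.2.
Qed.

Lemma clinear_scale_vec (E F : normedModType R) (g : E -> R^o) (e : F) :
  clinear g -> clinear (fun x => g x *: e).
Proof.
move=> gl; split=> [a x y|x].
  by rewrite gl.1 scalerDl scalerA.
by apply: cvgZl; exact: gl.2.
Qed.

Lemma clinear_bigsum (E F : normedModType R) I (s : seq I) (P : pred I)
    (T : I -> E -> F) :
  (forall i, P i -> clinear (T i)) ->
  clinear (fun x => \sum_(i <- s | P i) T i x).
Proof.
move=> Tl; elim: s => [|i s IH].
  under eq_fun do rewrite big_nil; exact: clinear_cst0.
under eq_fun do rewrite big_cons.
by case Pi: (P i) => //; apply: clinear_add => //; exact: Tl.
Qed.

Lemma clinear_coord m n (i : 'I_m) (j : 'I_n) :
  clinear (fun X : 'M[R]_(m, n) => X i j : R^o).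
Proof.
by split=> [a X Y|]; [rewrite !mxE|exact: coord_continuous].
Qed.

Lemma clinear_col (E : normedModType R) n (g : 'I_n -> E -> R^o) :
  (forall i, clinear (g i)) -> clinear (fun x => \col_i g i x : 'cV[R]_n).
Proof.
move=> gl.
have -> : (fun x => \col_i g i x : 'cV[R]_n) =
    fun x => \sum_i g i x *: delta_mx i 0.
  apply/funext => x; apply/matrixP => i k; rewrite ord1 mxE summxE.
  rewrite (bigD1 i)//= !mxE !eqxx mulr1 big1 ?addr0// => j ji.
  by rewrite !mxE eq_sym (negbTE ji) mulr0.
by apply: clinear_bigsum => i _; apply: clinear_scale_vec; exact: gl.
Qed.

Lemma clinear_mulmx m n (X : 'M[R]_(m, n)) :
  clinear (fun c : 'cV[R]_n => X *m c).
Proof.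
have -> : (fun c : 'cV[R]_n => X *m c) = fun c => \sum_j c j 0 *: col j X.
  apply/funext => c; apply/matrixP => i k; rewrite ord1 mxE summxE.
  by apply: eq_bigr => j _; rewrite !mxE mulrC.
by apply: clinear_bigsum => j _; apply: clinear_scale_vec; exact: clinear_coord.
Qed.

End ContinuousLinear.

(** * Differential operators and continuous linear maps *)
Section Calculus.
Context {R : realType} {N : nat}.
Variable Om : set 'rV[R]_N.
Hypothesis Om_open : open Om.

Let near_Om x (P : 'rV[R]_N -> Prop) :
  Om x -> (forall y, Om y -> P y) -> \forall y \near x, P y.
Proof.
move=> Ox OP; have : nbhs x Om by apply: open_nbhs_nbhs.
by apply: filterS.
Qed.

Section OneSpace.
Context {E : normedModType R}.
Implicit Types u v : 'rV[R]_N -> E.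

Lemma eq_partial j u v : (forall x, Om x -> u x = v x) ->
  forall x, Om x -> partial j u x = partial j v x.
Proof. by move=> uv x Ox; apply: near_eq_derive; exact: near_Om. Qed.

Lemma eq_partials w u v : (forall x, Om x -> u x = v x) ->
  forall x, Om x -> foldr partial u w x = foldr partial v w x.
Proof.
by move=> uv; elim: w => [//|j w IH] x Ox /=; exact: eq_partial.
Qed.

Lemma eq_Cr r u v : (forall x, Om x -> u x = v x) -> Cr r Om u -> Cr r Om v.
Proof.
elim: r u v => [|r IH] u v uv [uc uD]; split.
- move=> x Ox; rewrite /prop_for/continuous_at -uv//.
  apply: cvg_trans (uc x Ox); apply: (@near_eq_cvg _ _ (nbhs x)).
  exact: near_Om.
- by [].
- move=> x Ox; rewrite /prop_for/continuous_at -uv//.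
  apply: cvg_trans (uc x Ox); apply: (@near_eq_cvg _ _ (nbhs x)).
  exact: near_Om.
- move=> j; have [uj uCj] := uD j; split.
    by move=> x Ox; apply: near_eq_derivable (uj x Ox); exact: near_Om.
  by apply: IH uCj; exact: eq_partial.
Qed.

Lemma Cr_le r s u : (r <= s)%N -> Cr s Om u -> Cr r Om u.
Proof.
elim: r s u => [|r IH] [|s] u // rs [uc uD]; split=> // j.
by have [uj uCj] := uD j; split=> //; exact: IH uCj.
Qed.

Lemma Cr_partials r w u : Cr (size w + r) Om u -> Cr r Om (foldr partial u w).
Proof.
elim: w r => [//|j w IH] r; rewrite addSnnS => /IH[_ /(_ j)[]//].
Qed.

Lemma partials_derivable r w u j x : Cr r Om u -> (size w < r)%N -> Om x ->
  derivable (foldr partial u w) x (delta_mx 0 j).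
Proof.
move=> uC wr Ox; have : Cr (size w + 1) Om u by apply: Cr_le uC; rewrite addn1.
by move=> /Cr_partials[_ /(_ j)[+ _]]; exact.
Qed.

(** Turns the nested iteration of [Dmulti] into one fold of first-order partial
    derivatives, on which induction loses one order of smoothness per step. *)
Definition word (k : 'I_N -> nat) : seq 'I_N :=
  flatten [seq nseq (k j) j | j <- enum 'I_N].

Lemma size_word k : size (word k) = (\sum_j k j)%N.
Proof.
rewrite /word size_flatten /shape -map_comp sumnE big_map big_enum /=.
by apply: eq_bigr => j _; rewrite size_nseq.
Qed.

Lemma Dmulti_word k u : Dmulti k u = foldr partial u (word k).
Proof.
rewrite /Dmulti /word; elim: (enum 'I_N) => [//|j s IH] /=.
rewrite foldr_cat -IH; elim: (k j) => [//|i IHi] /=; by rewrite IHi.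
Qed.

Lemma eq_pdo_app L u v : (forall x, Om x -> u x = v x) ->
  forall x, Om x -> pdo_app L u x = pdo_app L v x.
Proof.
move=> uv x Ox; apply: eq_bigr => k _.
by rewrite !Dmulti_word (eq_partials _ uv).
Qed.

Lemma partial_cst0 (j : 'I_N) :
  partial j (fun _ : 'rV[R]_N => 0 : E) = fun=> 0.
Proof. by apply/funext => x; rewrite /partial derive_cst. Qed.

Lemma Cr_cst0 r : Cr r Om (fun _ : 'rV[R]_N => 0 : E).
Proof.
elim: r => [|r IH]; split=> //; try by move=> x _; exact: cst_continuous.
move=> j; rewrite partial_cst0; split=> // x _; exact: derivable_cst.
Qed.

Lemma pdo_app_cst0 L x : pdo_app L (fun _ : 'rV[R]_N => 0 : E) x = 0.
Proof.
apply: big1 => k _; rewrite Dmulti_word.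
suff -> (w : seq 'I_N) : foldr partial (fun _ : 'rV[R]_N => 0 : E) w = fun=> 0.
  by rewrite scaler0.
by elim: w => [//|j w /= ->]; rewrite partial_cst0.
Qed.

End OneSpace.

Lemma derive_clinear (E F : normedModType R) (T : E -> F)
    (u : 'rV[R]_N -> E) x v :
  clinear T -> derivable u x v ->
  is_derive x v (fun y => T (u y)) (T ('D_v u x)).
Proof.
move=> Tl /cvg_ex[/= l ul].
have Tul : (fun h => h^-1 *: (((fun y => T (u y)) \o shift x) (h *: v) -
    T (u x))) @ 0^' --> T l.
  under eq_fun do rewrite /= -(clinearB Tl) -(clinearZ Tl).
  by apply: continuous_cvg => //; exact: Tl.2.
split; first by apply/cvg_ex; exists (T l).
by rewrite /derive (cvg_lim _ Tul)// (cvg_lim _ ul).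
Qed.

(** The combination T u + v covers composition with T (take v = 0) and addition
    (take T = id) in one induction. *)
Section AddLinear.
Context {E F : normedModType R} (T : E -> F).
Hypothesis Tl : clinear T.
Implicit Types (u : 'rV[R]_N -> E) (v : 'rV[R]_N -> F).

Lemma partial_clinearD j u v x :
  derivable u x (delta_mx 0 j) -> derivable v x (delta_mx 0 j) ->
  derivable (fun y => T (u y) + v y) x (delta_mx 0 j) /\
  partial j (fun y => T (u y) + v y) x = T (partial j u x) + partial j v x.
Proof.
move=> /(derive_clinear Tl)[Tud TuE] vd; split; first exact: derivableD.
by rewrite /partial (deriveD Tud vd) TuE.
Qed.

Lemma Cr_clinearD r u v :
  Cr r Om u -> Cr r Om v -> Cr r Om (fun x => T (u x) + v x).
Proof.
have cD u' v' : (forall x, Om x -> {for x, continuous u'}) ->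
    (forall x, Om x -> {for x, continuous v'}) ->
    forall x, Om x -> {for x, continuous (fun y => T (u' y) + v' y)}.
  move=> uc vc x Ox.
  have Tuc : {for x, continuous (T \o u')}.
    by apply: continuous_comp; [exact: uc|exact: Tl.2].
  exact: (cvgD Tuc (vc x Ox)).
elim: r u v => [|r IH] u v [uc uD] [vc vD]; split=> //; try exact: cD.
move=> j; have [ud uC] := uD j; have [vd vC] := vD j.
have dE x Ox := partial_clinearD (ud x Ox) (vd x Ox).
split=> [x /dE[]//|]; apply: eq_Cr (IH _ _ uC vC) => x Ox.
by rewrite (dE x Ox).2.
Qed.

Lemma partials_clinearD r w u v x : (size w <= r)%N ->
  Cr r Om u -> Cr r Om v -> Om x ->
  foldr partial (fun y => T (u y) + v y) w x =
  T (foldr partial u w x) + foldr partial v w x.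
Proof.
move=> + uC vC; elim: w x => [//|j w IH] x wr Ox /=.
rewrite (eq_partial _ (fun y => IH y (ltnW wr)))//.
have ud : derivable (foldr partial u w) x (delta_mx 0 j).
  exact: partials_derivable uC wr Ox.
exact: (partial_clinearD ud (partials_derivable vC wr Ox)).2.
Qed.

Lemma pdo_app_clinearD r L u v x : (pdo_ord L <= r)%N ->
  Cr r Om u -> Cr r Om v -> Om x ->
  pdo_app L (fun y => T (u y) + v y) x = T (pdo_app L u x) + pdo_app L v x.
Proof.
move=> Lr uC vC Ox.
rewrite /pdo_app (clinear_sum Tl) -big_split /=; apply: eq_bigr => k kL.
rewrite !Dmulti_word (clinearZ Tl) -scalerDr; congr (_ *: _).
by apply: (partials_clinearD _ uC vC) => //; rewrite size_word (leq_trans kL).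
Qed.

Lemma Cr_clinear r u : Cr r Om u -> Cr r Om (fun x => T (u x)).
Proof.
move=> uC; apply: eq_Cr (Cr_clinearD uC (Cr_cst0 r)) => x _.
by rewrite addr0.
Qed.

Lemma pdo_app_clinear r L u x : (pdo_ord L <= r)%N -> Cr r Om u -> Om x ->
  pdo_app L (fun y => T (u y)) x = T (pdo_app L u x).
Proof.
move=> Lr uC Ox; have := pdo_app_clinearD Lr uC (Cr_cst0 r) Ox.
rewrite pdo_app_cst0 addr0 => <-.
by congr pdo_app; apply/funext => y; rewrite addr0.
Qed.

End AddLinear.

Section Sums.
Context {E : normedModType R}.
Implicit Types u v : 'rV[R]_N -> E.

Lemma Cr_add r u v : Cr r Om u -> Cr r Om v -> Cr r Om (fun x => u x + v x).
Proof. exact: (Cr_clinearD (clinear_id E)). Qed.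

Lemma pdo_app_add r L u v x : (pdo_ord L <= r)%N ->
  Cr r Om u -> Cr r Om v -> Om x ->
  pdo_app L (fun y => u y + v y) x = pdo_app L u x + pdo_app L v x.
Proof. exact: (pdo_app_clinearD (clinear_id E)). Qed.

Section Family.
Variables (I : Type) (s : seq I) (P : pred I).
Variables (u : I -> 'rV[R]_N -> E) (r : nat).
Hypothesis uC : forall i, P i -> Cr r Om (u i).

Lemma Cr_sum : Cr r Om (fun x => \sum_(i <- s | P i) u i x).
Proof.
elim: s => [|i s' IH].
  by under eq_fun do rewrite big_nil; exact: Cr_cst0.
under eq_fun do rewrite big_cons; case Pi: (P i) => //.
by apply: Cr_add => //; exact: uC.
Qed.

End Family.

Lemma pdo_app_sum I (s : seq I) (P : pred I) (u : I -> 'rV[R]_N -> E) r L x :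
  (pdo_ord L <= r)%N -> (forall i, P i -> Cr r Om (u i)) -> Om x ->
  pdo_app L (fun y => \sum_(i <- s | P i) u i y) x =
  \sum_(i <- s | P i) pdo_app L (u i) x.
Proof.
move=> Lr uC Ox; elim: s => [|i s IH].
  by under eq_fun do rewrite big_nil; rewrite big_nil pdo_app_cst0.
under eq_fun do rewrite big_cons; rewrite big_cons.
case Pi: (P i) => //; rewrite (pdo_app_add Lr) ?IH//; first exact: uC.
exact: Cr_sum.
Qed.

End Sums.

End Calculus.

(** * Closed operators *)
Section ClosedOperators.
Context {R : realType} {E1 E2 : normedModType R}.
Implicit Types A : closed_op E1 E2.

Lemma op0 A : A 0 = 0.
Proof.
have := clop_linear 1 (dom0 A) (dom0 A).
by rewrite !scale1r addr0 => /esym/eqP; rewrite -subr_eq0 addrK => /eqP.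
Qed.

Lemma dom_scale A a x : dom A x -> dom A (a *: x).
Proof.
by move=> Ax; rewrite -[_ *: _]addr0; apply: dom_lin => //; exact: dom0.
Qed.

Lemma dom_add A x y : dom A x -> dom A y -> dom A (x + y).
Proof. by move=> Ax Ay; rewrite -[x]scale1r; exact: dom_lin. Qed.

Lemma dom_sub A x y : dom A x -> dom A y -> dom A (x - y).
Proof. by move=> Ax Ay; rewrite addrC -scaleN1r; exact: dom_lin. Qed.

Lemma opD A x y : dom A x -> dom A y -> A (x + y) = A x + A y.
Proof. by move=> Ax Ay; rewrite -[x]scale1r clop_linear// !scale1r. Qed.

Lemma opB A x y : dom A x -> dom A y -> A (x - y) = A x - A y.
Proof.
by move=> Ax Ay; rewrite addrC -scaleN1r clop_linear// scaleN1r addrC.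
Qed.

Lemma dom_sum A I (s : seq I) (P : pred I) (c : I -> R) (e : I -> E1) :
  (forall i, P i -> dom A (e i)) -> dom A (\sum_(i <- s | P i) c i *: e i).
Proof.
move=> Ae; elim/big_ind: _ => [|x y|i /Ae].
- exact: dom0.
- exact: dom_add.
- exact: dom_scale.
Qed.

Lemma op_sum A I (s : seq I) (P : pred I) (c : I -> R) (e : I -> E1) :
  (forall i, P i -> dom A (e i)) ->
  A (\sum_(i <- s | P i) c i *: e i) = \sum_(i <- s | P i) c i *: A (e i).
Proof.
move=> Ae; elim: s => [|i s IH]; first by rewrite !big_nil op0.
rewrite !big_cons; case: ifPn => // Pi.
by rewrite clop_linear ?IH//; [exact: Ae|exact: dom_sum].
Qed.

Lemma adjP A (psi : E2 -> R^o) : adj_dom A psi -> adj_graph A psi (adj A psi).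
Proof. exact: xgetPex. Qed.

End ClosedOperators.

Lemma is_basis_mem (R : realType) (V : lmodType R) (S : set V) k
    (e : 'I_k -> V) i : is_basis S e -> S (e i).
Proof.
move=> [_ ->]; exists (fun j => (j == i)%:R) => //.
rewrite (bigD1 i)//= eqxx scale1r big1 ?addr0// => j /negbTE->.
by rewrite scale0r.
Qed.

(** The graph of A S is the preimage of the graph of A under the continuous map
    (y, z) |-> (S y, z). *)
Lemma closed_op_comp_clinear (R : realType) (E1 E2 F : completeNormedModType R)
    (A : closed_op E1 E2) (S : {linear F -> E1}) :
  continuous S -> (forall y, dom A (S y)) -> clinear (fun y => A (S y)).
Proof.
move=> Sc AS.
have ASlin : linear (fun y => A (S y)).
  by move=> a x y; rewrite linearP clop_linear.
pose T : {linear F -> E2} := HB.pack (fun y => A (S y))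
  (GRing.isLinear.Build _ _ _ _ (fun y => A (S y)) ASlin).
split=> //; apply: (@closed_graph _ _ _ T).
have -> : [set z : F * E2 | z.2 = T z.1] =
    (fun z : F * E2 => (S z.1, z.2)) @^-1`
      [set z : E1 * E2 | dom A z.1 /\ z.2 = A z.1].
  by apply/seteqP; split => z /=; [split|case].
have fc : continuous (fun z : F * E2 => (S z.1, z.2)).
  move=> z; apply: cvg_pair; last exact: cvg_snd.
  by apply: (continuous_comp (f := fst) (g := S)); [exact: cvg_fst|exact: Sc].
move/continuous_closedP: fc; apply; exact: clop_closed.
Qed.

(** * Complete Jordan sets and their projectors *)
Section JordanSets.
Context {R : realType} {E1 E2 : completeNormedModType R} {n m : nat}.
Variables (B A1 : closed_op E1 E2) (J : jordan_data E1 E2 n m).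
Hypothesis BA1 : dom B `<=` dom A1.
Hypothesis cj : complete_jordan B A1 J.

Local Notation gamma := (gam A1 J).
Local Notation P := (Pk A1 J).
Local Notation Q := (Qk A1 J).
Local Notation p := (jlen J).

Let extra i : (m <= i)%N -> (i < n)%N -> (m < n)%N.
Proof. exact: leq_ltn_trans. Qed.

Let rev_rg i j : (1 <= j <= p i)%N -> (1 <= (p i).+1 - j <= p i)%N.
Proof. lia. Qed.

Let one_rg i : (1 <= 1 <= p i)%N.
Proof. by rewrite (cj_len cj). Qed.

Lemma psi_clinear i j : (1 <= j <= p i)%N -> clinear (psi J i j).
Proof. by move=> /(cj_psi_dom cj)[_ /adjP[]]. Qed.

Lemma gam_clinear i j : (1 <= j <= p i)%N -> clinear (gamma i j).
Proof. by move=> /rev_rg/(cj_psi_dom cj)[_ /adjP[]]. Qed.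

Lemma psi_A1 i j u : (1 <= j <= p i)%N -> dom B u ->
  psi J i j (A1 u) = gamma i ((p i).+1 - j) u.
Proof.
move=> ij Bu; have [_ /adjP[_ _ H]] := cj_psi_dom cj ij.
by rewrite H ?/gam; [congr (adj A1 (psi J i _) u); lia|exact: BA1].
Qed.

Lemma psi1_B i u : dom B u -> psi J i 1 (B u) = 0.
Proof.
move=> Bu; have [/adjP[_ _ H] _] := cj_psi_dom cj (one_rg i).
rewrite H// (cj_psi1 cj).
by have [_ ->] := is_basis_mem (widen_ord (geq_minl m n) i) (cj_psi_basis cj).
Qed.

Lemma psiS_B i j u : (1 <= j < p i)%N -> dom B u ->
  psi J i j.+1 (B u) = gamma i ((p i).+1 - j) u.
Proof.
move=> ij Bu; have ij1 : (1 <= j.+1 <= p i)%N by lia.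
have [/adjP[_ _ H] _] := cj_psi_dom cj ij1.
by rewrite H// (cj_psi_chain cj)// /gam; congr (adj A1 (psi J i _) u); lia.
Qed.

Lemma phi_bas_kernel k : Defs.kernel B (phi_bas J k).
Proof. exact: is_basis_mem (cj_phi_basis cj). Qed.

Lemma dom_phi_bas k : dom B (phi_bas J k).
Proof. by have [] := phi_bas_kernel k. Qed.

Local Notation Ph := (Phi (J := J)).
Local Notation Ps := (Psi (J := J)).
Local Notation Ze := (Zet A1 (J := J)).

(** The functionals biorthogonal to [Phi], in the same enumeration. *)
Definition Gam (s : 'I_(jdim J)) : E1 -> R^o :=
  gamma (tagnat.sig1 s) (tagnat.sig2 s).+1.

Let rg (s : 'I_(jdim J)) : (1 <= (tagnat.sig2 s).+1 <= p (tagnat.sig1 s))%N.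
Proof. exact: ltn_ord. Qed.

Lemma sum_jdim (V : nmodType) (F : 'I_(minn m n) -> nat -> V) :
  \sum_i \sum_(1 <= j < (p i).+1) F i j =
  \sum_(s < jdim J) F (tagnat.sig1 s) (tagnat.sig2 s).+1.
Proof.
under eq_bigr do rewrite big_add1 big_mkord.
rewrite (sig_big_dep _ _ (fun i (j : 'I_(p i)) => F i j.+1)) /=.
by rewrite (reindex _ (onW_bij _ tagnat.sig_bij)).
Qed.

Lemma PE u : P u = \sum_s Gam s u *: Ph s.
Proof. exact: (sum_jdim (fun i j => gamma i j u *: phi J i j)). Qed.

Lemma QE y : Q y = \sum_s Ps s y *: Ze s.
Proof. exact: (sum_jdim (fun i j => psi J i j y *: zet A1 J i j)). Qed.

Lemma sig_eq (s t : 'I_(jdim J)) :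
  (tagnat.sig1 s == tagnat.sig1 t) &&
  ((tagnat.sig2 s).+1 == (tagnat.sig2 t).+1) = (s == t).
Proof. by rewrite eqSS -tagnat.eq_Rank !tagnat.sig2K. Qed.

Lemma flat_index i j : (1 <= j <= p i)%N ->
  exists t : 'I_(jdim J), tagnat.sig1 t = i /\ (tagnat.sig2 t).+1 = j.
Proof.
move=> /andP[j0 jp]; have jp' : (j.-1 < p i)%N by rewrite prednK.
exists (tagnat.Rank i (Ordinal jp')); split; first exact: tagnat.Rank1K.
by rewrite tagnat.Rank2K /= prednK.
Qed.

Lemma Gam_clinear s : clinear (Gam s). Proof. exact: gam_clinear. Qed.
Lemma Psi_clinear s : clinear (Ps s). Proof. exact: psi_clinear. Qed.

Lemma Gam_Phi s t : Gam s (Ph t) = (t == s)%:R.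
Proof. by rewrite /Gam /Phi (cj_biorth_phi cj)// sig_eq. Qed.

Lemma Psi_Zet s t : Ps s (Ze t) = (t == s)%:R.
Proof. by rewrite /Psi /Zet (cj_biorth_psi cj)// sig_eq. Qed.

Lemma dom_Phi s : dom B (Ph s).
Proof. exact: (cj_phi_dom cj). Qed.

Lemma Q_clinear : clinear Q.
Proof.
have -> : Q = fun y => \sum_s Ps s y *: Ze s by apply/funext => y; exact: QE.
by apply: clinear_bigsum => s _; apply: clinear_scale_vec; exact: Psi_clinear.
Qed.

Lemma dom_P u : dom B (P u).
Proof. by rewrite PE; apply: dom_sum => s _; exact: dom_Phi. Qed.

Lemma sum_delta (E : normedModType R) (T : 'I_(jdim J) -> E -> R^o)
    (e : 'I_(jdim J) -> E) (c : 'I_(jdim J) -> R) s :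
  (forall s, clinear (T s)) -> (forall s t, T s (e t) = (t == s)%:R) ->
  T s (\sum_t c t *: e t) = c s.
Proof.
move=> Tl Te; rewrite (clinear_sum (Tl s)) (bigD1 s)//= (clinearZ (Tl s)) Te.
rewrite eqxx big1 ?addr0 => [|t ts]; first exact: mulr1.
by rewrite (clinearZ (Tl s)) Te (negbTE ts) scaler0.
Qed.

Lemma Gam_P s u : Gam s (P u) = Gam s u.
Proof. by rewrite PE (sum_delta _ _ Gam_clinear Gam_Phi). Qed.

Lemma Psi_Q s y : Ps s (Q y) = Ps s y.
Proof. by rewrite QE (sum_delta _ _ Psi_clinear Psi_Zet). Qed.

Lemma gam_P i j u : (1 <= j <= p i)%N -> gamma i j (P u) = gamma i j u.
Proof. by move=> /flat_index[t [<- <-]]; exact: Gam_P. Qed.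

(** On D(B), each functional y |-> <B y, psi> is some gamma or zero, and P
    preserves the values of the gamma. *)
Lemma Psi_BP s u : dom B u -> Ps s (B (P u)) = Ps s (B u).
Proof.
move=> Bu; have BPu := dom_P u; rewrite /Psi.
have := rg s; case: (val _) => [|j] sj; first by rewrite !psi1_B.
by rewrite !psiS_B// gam_P//; lia.
Qed.

Lemma Psi_A1P s u : dom B u -> Ps s (A1 (P u)) = Ps s (A1 u).
Proof.
move=> Bu; have BPu := dom_P u; rewrite /Psi !psi_A1// gam_P//.
exact: rev_rg.
Qed.

Lemma op_PhiE A (M : 'M[R]_(jdim J)) c :
  dom B `<=` dom A -> represents A1 A M ->
  A (\sum_s c s *: Ph s) = \sum_t (\sum_s c s * M s t) *: Ze t.
Proof.
move=> BA AM; rewrite op_sum => [|s _]; last exact/BA/dom_Phi.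
under [RHS]eq_bigr do rewrite scaler_suml.
rewrite exchange_big; apply: eq_bigr => s _.
by rewrite AM scaler_sumr; apply: eq_bigr => t _; rewrite scalerA.
Qed.

Lemma Q_sumZet c : Q (\sum_t c t *: Ze t) = \sum_t c t *: Ze t.
Proof.
rewrite QE; apply: eq_bigr => s _.
by rewrite (sum_delta _ _ Psi_clinear Psi_Zet).
Qed.

(** A P u is a combination of the Zet, so Q fixes it, and Q A u is determined by
    the Psi-coordinates of A u.  This gives the intertwining relation of B and
    of A_1 without reindexing the Jordan chains. *)
Lemma commutes_of_Psi A (M : 'M[R]_(jdim J)) :
  dom B `<=` dom A -> represents A1 A M ->
  (forall s u, dom B u -> Ps s (A (P u)) = Ps s (A u)) ->
  forall u, dom B u -> A (P u) = Q (A u).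
Proof.
move=> BA AM PsA u Bu.
have -> : Q (A u) = Q (A (P u)).
  by rewrite !QE; apply: eq_bigr => s _; rewrite PsA.
by rewrite PE (op_PhiE _ BA AM) Q_sumZet.
Qed.

Lemma represents_entry A (M : 'M[R]_(jdim J)) s t :
  represents A1 A M -> Ps t (A (Ph s)) = M s t.
Proof. by move=> ->; rewrite (sum_delta _ _ Psi_clinear Psi_Zet). Qed.

(** B sends phi_i^(j) to z_i^(p_i + 2 - j), and kills it for j = 1: the nonzero
    entries lie on antidiagonals of the diagonal blocks. *)
Lemma represents_B_sym (MB : 'M[R]_(jdim J)) : represents A1 B MB -> MB^T = MB.
Proof.
move=> BM.
have BME s t : MB s t = ((tagnat.sig1 s == tagnat.sig1 t) &&
    (tagnat.sig2 s + tagnat.sig2 t == p (tagnat.sig1 s))%N)%:R.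
  rewrite -(represents_entry s t BM) /Psi.
  case tE: (val (tagnat.sig2 t)) (rg t) => [|j] tj.
    rewrite psi1_B; last exact: dom_Phi.
    have := rg s.
    by case: eqP => //= _; case: eqP => //; lia.
  rewrite psiS_B; [|lia|exact: dom_Phi].
  rewrite /Phi (cj_biorth_phi cj)//; last by lia.
  case: eqP => //= E; congr (nat_of_bool _)%:R.
  by have := congr1 p E; have := rg s; lia.
apply/matrixP => s t.
rewrite mxE !BME [tagnat.sig1 t == _]eq_sym [(tagnat.sig2 t + _)%N]addnC.
by case: eqP => //= /(congr1 p) pE; rewrite -[X in _ == X]pE.
Qed.

Lemma op_pairPhi A (M : 'M[R]_(jdim J)) c :
  dom B `<=` dom A -> represents A1 A M ->
  A (pairPhi c) = \sum_t (M^T *m c) t 0 *: Ze t.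
Proof.
move=> BA AM; rewrite /pairPhi (op_PhiE _ BA AM); apply: eq_bigr => t _.
congr (_ *: _); rewrite mxE; apply: eq_bigr => s _.
by rewrite mxE mulrC.
Qed.

(** * The range of B and the pseudoinverse *)

Hypotheses (mn : (m <= n)%N) (noeth : noetherian B n m).

Let l_m : minn m n = m. Proof. exact/minn_idPl. Qed.

Lemma phi_bas_first (k : 'I_n) : (k < m)%N ->
  exists2 i : 'I_(minn m n), k = i :> nat & phi_bas J k = phi J i 1.
Proof.
move=> km; have ki : (k < minn m n)%N by rewrite l_m.
exists (Ordinal ki) => //; rewrite (cj_phi1 cj); congr phi_bas.
exact: val_inj.
Qed.

Lemma gam1_phi_bas i k : gamma i 1 (phi_bas J k) = (i == k :> nat)%:R.
Proof.
have [km|mk] := ltnP k m; last first.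
  have ne : (i == k :> nat) = false.
    by apply/eqP; have := ltn_ord i; rewrite [X in (_ < X)%N]l_m; lia.
  by rewrite (cj_extra_gam cj) ?ne// (extra mk).
have [i' -> ->] := phi_bas_first km.
by rewrite (cj_biorth_phi cj) ?one_rg// andbT eq_sym.
Qed.

Lemma gam_phi_extra i j (k : 'I_n) : (m <= k)%N -> (1 <= j <= p i)%N ->
  gamma i j (phi_bas J k) = 0.
Proof. by move=> mk ij; apply: (cj_extra_gam cj) => //; exact: extra mk _. Qed.

Lemma gam_bas_phi_bas (s k : 'I_n) : (m <= s)%N ->
  gam_bas J s (phi_bas J k) = (k == s)%:R.
Proof.
move=> ms; have mltn := extra ms (ltn_ord s).
have [km|mk] := ltnP k m; last exact: (cj_extra_biorth cj).
have [i ki ->] := phi_bas_first km.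
rewrite (cj_extra_phi cj) ?one_rg//.
suff -> : (k == s) = false by [].
by apply/eqP => ks; move: km; rewrite ks ltnNge ms.
Qed.

Lemma gam_bas_clinear (s : 'I_n) : (m <= s)%N -> clinear (gam_bas J s).
Proof. by move=> ms; apply: (cj_extra_dual cj) => //; exact: extra ms _. Qed.

(** These functionals form the basis dual to phi_1, ..., phi_n. *)
Lemma kernel_eq0 x : Defs.kernel B x -> (forall i, gamma i 1 x = 0) ->
  (forall s : 'I_n, (m <= s)%N -> gam_bas J s x = 0) -> x = 0.
Proof.
have [_ ->] := cj_phi_basis cj; move=> [c _ <-] g1 g2.
apply: big1 => k _; suff -> : c k = 0 by rewrite scale0r.
have [km|mk] := ltnP k m.
  have [i ki _] := phi_bas_first km.
  rewrite -(g1 i) (clinear_sum (gam_clinear (one_rg i))) (bigD1 k)//=.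
  rewrite (clinearZ (gam_clinear (one_rg i))) gam1_phi_bas ki eqxx.
  rewrite big1 ?addr0 => [|k' kk']; first by rewrite [RHS]mulr1.
  rewrite (clinearZ (gam_clinear (one_rg i))) gam1_phi_bas -ki.
  by rewrite val_eqE eq_sym (negbTE kk') scaler0.
rewrite -(g2 k mk) (clinear_sum (gam_bas_clinear mk)) (bigD1 k)//=.
rewrite (clinearZ (gam_bas_clinear mk)) gam_bas_phi_bas// eqxx.
rewrite big1 ?addr0 => [|k' kk']; first by rewrite [RHS]mulr1.
rewrite (clinearZ (gam_bas_clinear mk)) gam_bas_phi_bas//.
by rewrite (negbTE kk') scaler0.
Qed.

(** A functional separating y from the closed range vanishes on the range, so it
    belongs to the kernel of the adjoint, whose basis vanishes at y. *)
Lemma op_rangeP y : op_range B y <-> forall i, psi J i 1 y = 0.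
Proof.
split=> [[u Bu <-] i|psiy]; first exact: psi1_B.
apply: contrapT => By; have [Bcl _ _] := noeth.
have [||g [gdual gB gy]] := separate_closed_subspace _ _ Bcl By.
- by exists 0; [exact: dom0|exact: op0].
- move=> a _ _ [x Bx <-] [z Bz <-].
  by exists (a *: x + z); [exact: dom_lin|exact: clop_linear].
have gadj : adj_graph B g 0.
  split=> // [|x Bx]; first exact: clinear_cst0.
  by rewrite gB//; exists x.
have : adj_kernel B g.
  have gd : adj_dom B g by exists 0.
  split=> //; apply/funext.
  have [_ hdual hB] := adjP gd.
  have zero_on_dom x : dom B x -> adj B g x = 0.
    by move=> Bx; rewrite -hB// gB//; exists x.
  move=> x; apply/eqP; apply: contrapT => hx.
  have [||z [/= hz Bz]] := @dom_dense _ _ _ B (adj B g @^-1` [set r | r != 0]).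
  - by exists x; exact/negP.
  - apply: open_comp; first by move=> z _; exact: hdual.2.
    exact: open_neq.
  - by move/eqP: hz; apply; exact: zero_on_dom.
have [_ ->] := cj_psi_basis cj; move=> [c _ gE].
move: gy; rewrite -gE fct_sumE big1 ?eqxx// => k _.
have kl : (k < minn m n)%N by rewrite l_m.
rewrite -[LHS]/(c k * psi_bas J k y) (_ : psi_bas J k = psi J (Ordinal kl) 1).
  by rewrite psiy mulr0.
by rewrite (cj_psi1 cj); congr psi_bas; exact: val_inj.
Qed.

Section Pseudoinverse.
Variables (Bp : {linear E2 -> E1}) (MB : 'M[R]_(jdim J)).
Hypotheses (Bp_inv : is_pseudoinverse B A1 J Bp) (BM : represents A1 B MB).

Let Bp_cont : continuous Bp. Proof. by have [] := Bp_inv. Qed.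

Lemma Bp_clinear : clinear Bp.
Proof. exact: clinear_of. Qed.

Lemma psi1_zet1 i s : psi J i 1 (zet A1 J s 1) = (s == i)%:R.
Proof. by rewrite (cj_biorth_psi cj) ?one_rg// andbT. Qed.

(** Removing from y its components along the z_i^(1), where B^+ vanishes, puts
    it into the range of B. *)
Lemma dom_Bp y : dom B (Bp y).
Proof.
have [_ Bpz BpR] := Bp_inv.
pose y' := y - \sum_i psi J i 1 y *: zet A1 J i 1.
have -> : Bp y = Bp y'.
  rewrite linearB linear_sum big1 ?subr0// => i _.
  by rewrite linearZ/= Bpz scaler0.
suff /BpR[] : op_range B y' by [].
apply/op_rangeP => i.
have il := psi_clinear (one_rg i).
rewrite (clinearB il) (clinear_sum il) (bigD1 i)//= (clinearZ il).
rewrite psi1_zet1 eqxx big1 ?addr0 => [|s si].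
  by rewrite [X in _ - X]mulr1 subrr.
by rewrite (clinearZ il) psi1_zet1 (negbTE si) scaler0.
Qed.

Lemma pseudoinverse_unique w : dom B w -> (forall i, gamma i 1 w = 0) ->
  (forall s : 'I_n, (m <= s)%N -> gam_bas J s w = 0) -> Bp (B w) = w.
Proof.
move=> Bw g1 g2; have [_ _ BpR] := Bp_inv.
have [|Bv BvE v1 v2] := BpR (B w); first by exists w.
apply/eqP; rewrite -subr_eq0; apply/eqP; apply: kernel_eq0.
- by split; [exact: dom_sub|rewrite opB// BvE subrr].
- move=> i; rewrite (clinearB (gam_clinear (one_rg i))) v1 g1.
  exact: subrr.
- by move=> s ms; rewrite (clinearB (gam_bas_clinear ms)) v2// g2// subrr.
Qed.

Lemma op_Bp_clinear (A : closed_op E1 E2) :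
  dom B `<=` dom A -> clinear (fun y => A (Bp y)).
Proof.
by move=> BA; apply: closed_op_comp_clinear => // y; exact/BA/dom_Bp.
Qed.

Lemma B_commutes u : dom B u -> B (P u) = Q (B u).
Proof.
move=> Bu; apply: (commutes_of_Psi _ BM) => // s v; exact: Psi_BP.
Qed.

Lemma pseudoinverse_decomposition u : dom B u ->
  u = Bp (B u - Q (B u)) + P u
      + \sum_(i < n | (m <= i)%N) gam_bas J i u *: phi_bas J i.
Proof.
move=> Bu; set S := (X in _ + X).
have BS : dom B S by apply: dom_sum => i _; exact: dom_phi_bas.
have BPu := dom_P u.
have S0 : B S = 0.
  rewrite op_sum => [|i _]; last exact: dom_phi_bas.
  by apply: big1 => i _; have [_ ->] := phi_bas_kernel i; rewrite scaler0.
have Bw : dom B (u - P u - S) by do 2 ![apply: dom_sub => //].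
have BwE : B (u - P u - S) = B u - Q (B u).
  by rewrite !opB ?S0 ?subr0 ?B_commutes//; exact: dom_sub.
rewrite -BwE pseudoinverse_unique//; first by rewrite [_ - S + _]addrAC !subrK.
  move=> i.
  have il := gam_clinear (one_rg i).
  rewrite !(clinearB il) gam_P ?one_rg// subrr sub0r (clinear_sum il).
  rewrite big1 ?oppr0// => k mk; rewrite (clinearZ il).
  by rewrite gam_phi_extra ?one_rg// scaler0.
move=> s ms; have sl := gam_bas_clinear ms.
have P0 : gam_bas J s (P u) = 0.
  rewrite PE (clinear_sum sl) big1// => t _.
  rewrite (clinearZ sl) /Phi (cj_extra_phi cj) ?scaler0//.
  exact: extra ms _.
have SE : gam_bas J s S = gam_bas J s u.
  rewrite /S (clinear_sum sl) (bigD1 s)//= (clinearZ sl) gam_bas_phi_bas//.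
  rewrite eqxx [X in X + _]mulr1 big1 ?addr0// => k /andP[mk ks].
  by rewrite (clinearZ sl) gam_bas_phi_bas// (negbTE ks) scaler0.
by rewrite !(clinearB sl) P0 SE subr0 subrr.
Qed.

Lemma coQ_Psi v s : coQk_range A1 J v -> Ps s v = 0.
Proof.
by move=> [y _ <-]; rewrite (clinearB (Psi_clinear s)) Psi_Q subrr.
Qed.

Lemma psi_Psi v i j : (forall s, Ps s v = 0) -> (1 <= j <= p i)%N ->
  psi J i j v = 0.
Proof. by move=> v0 /flat_index[t [<- <-]]; exact: v0. Qed.

Lemma B_Bp v : coQk_range A1 J v -> B (Bp v) = v.
Proof.
move=> Qv; have [_ _ BpR] := Bp_inv.
suff /BpR[] : op_range B v by [].
apply/op_rangeP => i.
by apply: psi_Psi; [move=> s; exact: coQ_Psi|exact: one_rg].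
Qed.

(** gamma^(1) vanishes on the range of B^+ by the choice of B^+, and for j > 1
    the value of gamma^(j) at B^+ v is that of some psi at B B^+ v = v. *)
Lemma P_Bp v : coQk_range A1 J v -> P (Bp v) = 0.
Proof.
move=> Qv; rewrite /Pk big1// => i _; rewrite big_nat_cond big1// => j.
rewrite andbT => /andP[j0 jp].
suff -> : gamma i j (Bp v) = 0 by rewrite scale0r.
have [_ _ BpR] := Bp_inv.
have [|_ _ g1 _] := BpR v.
  by apply/op_rangeP => k; apply: psi_Psi (one_rg k) => s; exact: coQ_Psi.
have [->|j1] := eqVneq j 1%N; first exact: g1.
have -> : j = ((p i).+1 - ((p i).+1 - j))%N by lia.
rewrite -psiS_B; [|lia|exact: dom_Bp].
by rewrite B_Bp//; apply: psi_Psi; [move=> s; exact: coQ_Psi|lia].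
Qed.

Section Commuting.
Variable A : closed_op E1 E2.
Hypothesis AC : forall u, dom B u -> A (P u) = Q (A u).

Lemma Psi_op_Bp s v : coQk_range A1 J v -> Ps s (A (Bp v)) = 0.
Proof.
move=> Qv; rewrite -Psi_Q -AC; last exact: dom_Bp.
rewrite P_Bp// op0.
exact: clinear0 (Psi_clinear s).
Qed.

Lemma Psi_op_phi_bas s (k : 'I_n) : (m <= k)%N -> Ps s (A (phi_bas J k)) = 0.
Proof.
move=> mk; rewrite -Psi_Q -AC; last exact: dom_phi_bas.
rewrite PE big1 => [|t _]; first by rewrite op0 (clinear0 (Psi_clinear s)).
by rewrite /Gam gam_phi_extra// scale0r.
Qed.

End Commuting.

End Pseudoinverse.


(** * Splitting the equation *)
Section Reduction.
Variables (N q r : nat) (Om : set 'rV[R]_N) (A : nat -> closed_op E1 E2).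
Variables (L : nat -> pdo R N) (Bp : {linear E2 -> E1}).
Variables (MB : 'M[R]_(jdim J)) (M : nat -> 'M[R]_(jdim J)).
Hypotheses (Om_open : open Om) (Bp_inv : is_pseudoinverse B A1 J Bp).
Hypothesis Lr : forall k, (k <= q)%N -> (pdo_ord (L k) <= r)%N.
Hypothesis BA : forall k, (1 <= k <= q)%N -> dom B `<=` dom (A k).
Hypothesis AC : forall k, (1 <= k <= q)%N ->
  forall u, dom B u -> A k (P u) = Q (A k u).
Hypotheses (BM : represents A1 B MB)
  (AM : forall k, (1 <= k <= q)%N -> represents A1 (A k) (M k)).

Variables (v : 'rV[R]_N -> E2) (C : 'rV[R]_N -> 'cV[R]_(jdim J)).
Variable lam : 'I_n -> 'rV[R]_N -> R^o.
Hypotheses (v_Cr : Cr r Om v) (C_Cr : Cr r Om C)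
  (lam_Cr : forall i : 'I_n, (m <= i)%N -> Cr r Om (lam i)).
Hypothesis v_coQ : forall x, Om x -> coQk_range A1 J (v x).

Definition assembled (x : 'rV[R]_N) : E1 :=
  Bp (v x) + pairPhi (C x) + \sum_(i < n | (m <= i)%N) lam i x *: phi_bas J i.

Definition combZet (c : 'cV[R]_(jdim J)) : E2 := \sum_t c t 0 *: Ze t.

Lemma combZet_clinear : clinear combZet.
Proof.
by apply: clinear_bigsum => t _; apply: clinear_scale_vec; exact: clinear_coord.
Qed.

Lemma Psi_combZet c s : Ps s (combZet c) = c s 0.
Proof. exact: (sum_delta _ _ Psi_clinear Psi_Zet). Qed.

Lemma Q_combZet y : Q y = combZet (pairPsi J y).
Proof. by rewrite QE; apply: eq_bigr => s _; rewrite mxE. Qed.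

Lemma pairPhi_clinear : clinear (pairPhi (J := J)).
Proof.
by apply: clinear_bigsum => t _; apply: clinear_scale_vec; exact: clinear_coord.
Qed.

Let dom_pairPhi c : dom B (pairPhi (J := J) c).
Proof. by apply: dom_sum => s _; exact: dom_Phi. Qed.

Let dom_extra x : dom B (\sum_(i < n | (m <= i)%N) lam i x *: phi_bas J i).
Proof. by apply: dom_sum => i _; exact: dom_phi_bas. Qed.

Let dom_BpPhi x : dom B (Bp (v x) + pairPhi (C x)).
Proof. by apply: dom_add; [exact: dom_Bp|exact: dom_pairPhi]. Qed.

Lemma dom_assembled x : dom B (assembled x).
Proof. by apply: dom_add; [exact: dom_BpPhi|exact: dom_extra]. Qed.

Lemma B_assembled x : Om x -> B (assembled x) = v x + combZet (MB *m C x).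
Proof.
move=> Ox; have [d1 d2] := (dom_Bp Bp_inv (v x), dom_pairPhi (C x)).
have [d3 d4] := (dom_BpPhi x, dom_extra x).
rewrite /assembled !opD//.
rewrite B_Bp//; last exact: v_coQ.
rewrite (op_pairPhi _ _ BM)// (represents_B_sym BM).
rewrite op_sum => [|i _]; last exact: dom_phi_bas.
rewrite [X in _ + X]big1 ?addr0// => i _.
by have [_ ->] := phi_bas_kernel i; rewrite scaler0.
Qed.

Lemma A_assembled k x : (1 <= k <= q)%N ->
  A k (assembled x) = A k (Bp (v x)) + combZet ((M k)^T *m C x)
    + \sum_(i < n | (m <= i)%N) lam i x *: A k (phi_bas J i).
Proof.
move=> kq; have Bk := BA kq.
have [d1 d2] := (Bk _ (dom_Bp Bp_inv (v x)), Bk _ (dom_pairPhi (C x))).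
have [d3 d4] := (Bk _ (dom_BpPhi x), Bk _ (dom_extra x)).
rewrite /assembled !opD//.
rewrite (op_pairPhi _ Bk (AM kq)) op_sum// => i _.
by apply: Bk; exact: dom_phi_bas.
Qed.

Let lam_vec_Cr (E : normedModType R) (e : 'I_n -> E) (i : 'I_n) : (m <= i)%N ->
  Cr r Om (fun x => lam i x *: e i).
Proof.
move=> mi; apply: (Cr_clinear Om_open (T := fun c : R^o => c *: e i)).
  by apply: clinear_scale_vec; exact: clinear_id.
exact: lam_Cr.
Qed.

Let BpPhi_Cr : Cr r Om (fun x => Bp (v x) + pairPhi (C x)).
Proof.
apply: Cr_add => //.
  by apply: Cr_clinear => //; exact: Bp_clinear.
by apply: Cr_clinear => //; exact: pairPhi_clinear.
Qed.

Lemma assembled_Cr : Cr r Om assembled.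
Proof.
apply: Cr_add => //; apply: Cr_sum => // i mi; exact: lam_vec_Cr.
Qed.

Let comb_Cr (X : 'M[R]_(jdim J)) : Cr r Om (fun x => combZet (X *m C x)).
Proof.
apply: (Cr_clinear Om_open (T := fun c => combZet (X *m c))) => //.
by apply: clinear_comp; [exact: combZet_clinear|exact: clinear_mulmx].
Qed.

Let pdo_comb k (X : 'M[R]_(jdim J)) x : (k <= q)%N -> Om x ->
  pdo_app (L k) (fun y => combZet (X *m C y)) x =
  combZet (pdo_app (L k) (fun y => X *m C y) x).
Proof.
move=> kq Ox; apply: (pdo_app_clinear Om_open combZet_clinear (Lr kq)) => //.
by apply: Cr_clinear => //; exact: clinear_mulmx.
Qed.

Lemma B_assembled_Cr : Cr r Om (fun x => B (assembled x)).
Proof.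
apply: (eq_Cr Om_open (u := fun x => v x + combZet (MB *m C x))).
  by move=> x Ox; rewrite B_assembled.
exact: Cr_add.
Qed.

Lemma pdo_B_assembled x : Om x ->
  pdo_app (L 0) (fun y => B (assembled y)) x =
  pdo_app (L 0) v x + combZet (pdo_app (L 0) (fun y => MB *m C y) x).
Proof.
move=> Ox; rewrite (eq_pdo_app Om_open _ B_assembled)//.
by rewrite (pdo_app_add Om_open (Lr (leq0n q)))// pdo_comb.
Qed.

Let A_Bp_Cr k : (1 <= k <= q)%N -> Cr r Om (fun x => A k (Bp (v x))).
Proof.
move=> kq; apply: (Cr_clinear Om_open (T := fun y => A k (Bp y))) => //.
exact: op_Bp_clinear (BA kq).
Qed.

(** Boundedness of A_k B^+ makes the first summand as smooth as v, so L_k may be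
    applied to the three summands separately. *)
Lemma pdo_A_assembled k x : (1 <= k <= q)%N -> Om x ->
  pdo_app (L k) (fun y => A k (assembled y)) x =
  pdo_app (L k) (fun y => A k (Bp (v y))) x
  + combZet (pdo_app (L k) (fun y => (M k)^T *m C y) x)
  + \sum_(i < n | (m <= i)%N)
      pdo_app (L k) (fun y => lam i y *: A k (phi_bas J i)) x.
Proof.
move=> kq Ox; have kq' : (k <= q)%N by lia.
have ACr := A_Bp_Cr kq.
have lamCr (i : 'I_n) : (m <= i)%N ->
    Cr r Om (fun x => lam i x *: A k (phi_bas J i)).
  exact: (lam_vec_Cr (fun i => A k (phi_bas J i))).
rewrite (eq_pdo_app Om_open _ (fun y _ => A_assembled y kq))//.
rewrite (pdo_app_add Om_open (Lr kq'))//; [|exact: Cr_add|exact: Cr_sum].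
rewrite (pdo_app_add Om_open (Lr kq'))// pdo_comb//.
by rewrite (pdo_app_sum Om_open _ (Lr kq')).
Qed.

Let regular_lhs x := pdo_app (L 0) v x
  + \sum_(1 <= k < q.+1) pdo_app (L k) (fun y => A k (Bp (v y))) x.
Let coef_lhs x := pdo_app (L 0) (fun y => MB *m C y) x
  + \sum_(1 <= k < q.+1) pdo_app (L k) (fun y => (M k)^T *m C y) x.
Let extra_terms a x := \sum_(a <= k < q.+1) \sum_(i < n | (m <= i)%N)
  pdo_app (L k) (fun y => lam i y *: A k (phi_bas J i)) x.

Let lhs_split x : Om x ->
  pdo_app (L 0) (fun y => B (assembled y)) x
  + \sum_(1 <= k < q.+1) pdo_app (L k) (fun y => A k (assembled y)) x =
  regular_lhs x + extra_terms 1 x + combZet (coef_lhs x).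
Proof.
move=> Ox; rewrite pdo_B_assembled//.
rewrite (eq_big_nat _ _ (fun k (kq : (1 <= k < q.+1)%N) =>
  pdo_A_assembled (kq : (1 <= k <= q)%N) Ox)) !big_split/=.
rewrite /coef_lhs (clinearD combZet_clinear) (clinear_sum combZet_clinear).
rewrite /regular_lhs /extra_terms.
by rewrite [X in _ + X = _]addrAC addrACA; congr (_ + _); rewrite addrA.
Qed.

Let Psi_pdo0 (g : 'rV[R]_N -> E2) s k x : (k <= q)%N -> Cr r Om g ->
  (forall y, Om y -> Ps s (g y) = 0) -> Om x -> Ps s (pdo_app (L k) g x) = 0.
Proof.
move=> kq gC g0 Ox.
rewrite -(pdo_app_clinear Om_open (Psi_clinear s) (Lr kq))//.
by rewrite (eq_pdo_app Om_open _ g0)// pdo_app_cst0.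
Qed.

Let Psi_regular_lhs s x : Om x -> Ps s (regular_lhs x) = 0.
Proof.
move=> Ox; have sl := Psi_clinear s.
rewrite (clinearD sl) (clinear_sum sl) Psi_pdo0//; last first.
  by move=> y Oy; apply: coQ_Psi; exact: v_coQ.
rewrite add0r big_nat_cond big1// => k; rewrite andbT => kq.
apply: Psi_pdo0 => //; [lia|exact: A_Bp_Cr|move=> y Oy].
by apply: Psi_op_Bp => //; [exact: AC|exact: v_coQ].
Qed.

Let Psi_extra_terms s a x : (0 < a)%N -> Om x -> Ps s (extra_terms a x) = 0.
Proof.
move=> a0 Ox; have sl := Psi_clinear s.
rewrite (clinear_sum sl) big_nat_cond big1// => k; rewrite andbT => kq.
rewrite (clinear_sum sl) big1// => i mi; apply: Psi_pdo0 => //; first by lia.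
  exact: (lam_vec_Cr (fun i => A k (phi_bas J i))).
have kq' : (1 <= k <= q)%N by lia.
by move=> y Oy; rewrite (clinearZ sl) Psi_op_phi_bas ?scaler0//; exact: AC.
Qed.

(** The left-hand side of the equation is the sum of the regular part, which all
    the Psi annihilate, and of a combination of the Zet whose coefficients are
    the left-hand side of the system; Q reads off the latter. *)
Lemma equation_splits x (y : E2) : Om x ->
  pdo_app (L 0) (fun z => B (assembled z)) x
  + \sum_(1 <= k < q.+1) pdo_app (L k) (fun z => A k (assembled z)) x = y
  <->
  regular_lhs x = (y - Q y) - extra_terms 1 x /\
  coef_lhs x = pairPsi J (y - extra_terms 2 x).
Proof.
move=> Ox; rewrite lhs_split//.
have -> : pairPsi J (y - extra_terms 2 x) = pairPsi J y.
  apply/matrixP => s i; rewrite !mxE (clinearB (Psi_clinear s)).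
  by rewrite Psi_extra_terms ?subr0.
have Ps0 s : Ps s (regular_lhs x + extra_terms 1 x) = 0.
  rewrite (clinearD (Psi_clinear s)) Psi_regular_lhs//.
  by rewrite Psi_extra_terms ?addr0.
split=> [<-|[-> ->]]; last by rewrite subrK -Q_combZet subrK.
have coefE :
    pairPsi J (regular_lhs x + extra_terms 1 x + combZet (coef_lhs x)) =
    coef_lhs x.
  apply/matrixP => s i; rewrite ord1 [LHS]mxE (clinearD (Psi_clinear s)) Ps0.
  by rewrite add0r Psi_combZet.
by split; [rewrite Q_combZet coefE !addrK|rewrite coefE].
Qed.

End Reduction.

End JordanSets.

(** * The representation of solutions *)

Theorem theorem1 (R : realType) (E1 E2 : completeNormedModType R)
  (N q n m r : nat) (Om : set 'rV[R]_N)
  (B : closed_op E1 E2) (A : nat -> closed_op E1 E2)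
  (L : nat -> pdo R N) (f : 'rV[R]_N -> E2)
  (J : jordan_data E1 E2 n m) (Bp : {linear E2 -> E1})
  (MB : 'M[R]_(jdim J)) (M : nat -> 'M[R]_(jdim J)) :
  open Om ->
  (0 < q)%N ->
  (m <= n)%N ->
  noetherian B n m ->
  (forall i, (1 <= i <= q)%N -> dom B `<=` dom (A i)) ->
  (forall i, (i < q)%N -> (pdo_ord (L i.+1) < pdo_ord (L i))%N) ->
  (* "sufficiently smooth" *)
  (pdo_ord (L 0%N) <= r)%N ->
  (forall i, (i <= q)%N -> pdo_smooth (r - pdo_ord (L 0%N)) Om (L i)) ->
  Cr (r - pdo_ord (L 0%N)) Om f ->
  (* Condition 1 *)
  complete_jordan B (A 1%N) J ->
  (* Condition 2 *)
  (forall i, (2 <= i <= q)%N -> commutes (Pk (A 1%N) J) (Qk (A 1%N) J) (A i)) ->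
  (* the pseudoinverse B^+ and the matrices A_B, A_i *)
  is_pseudoinverse B (A 1%N) J Bp ->
  represents (A 1%N) B MB ->
  (forall i, (1 <= i <= q)%N -> represents (A 1%N) (A i) (M i)) ->
  (forall u : 'rV[R]_N -> E1, is_solution r Om q B A L f u ->
     exists (v : 'rV[R]_N -> E2) (C : 'rV[R]_N -> 'cV[R]_(jdim J))
            (lam : 'I_n -> 'rV[R]_N -> R^o),
       [/\ [/\ Cr r Om v, Cr r Om C &
               forall i : 'I_n, (m <= i)%N -> Cr r Om (lam i)],
           forall x, Om x -> coQk_range (A 1%N) J (v x),
           regular_eq Om q A L f J Bp lam v,
           coef_system Om q A L f MB M lam C &
           forall x, Om x ->
             u x = Bp (v x) + pairPhi (C x)
                   + \sum_(i < n | (m <= i)%N) lam i x *: phi_bas J i])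
  /\
  (forall (lam : 'I_n -> 'rV[R]_N -> R^o) (v : 'rV[R]_N -> E2)
          (C : 'rV[R]_N -> 'cV[R]_(jdim J)),
     (forall i : 'I_n, (m <= i)%N -> Cr r Om (lam i)) ->
     Cr r Om v -> Cr r Om C ->
     (forall x, Om x -> coQk_range (A 1%N) J (v x)) ->
     regular_eq Om q A L f J Bp lam v ->
     coef_system Om q A L f MB M lam C ->
     is_solution r Om q B A L f
       (fun x => Bp (v x) + pairPhi (C x)
                 + \sum_(i < n | (m <= i)%N) lam i x *: phi_bas J i)).
Proof.
move=> Om_open q0 mn noeth BA Lord Lr _ _ cj AC Bp_inv BM AM.
have q1 : (1 <= 1 <= q)%N by rewrite q0.
have Lk k : (k <= q)%N -> (pdo_ord (L k) <= r)%N.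
  elim: k => [//|k IH] kq; exact: leq_trans (ltnW (Lord k kq)) (IH (ltnW kq)).
have ACk k : (1 <= k <= q)%N -> forall u, dom B u ->
    A k (Pk (A 1%N) J u) = Qk (A 1%N) J (A k u).
  move=> kq u Bu; have [->|k1] := eqVneq k 1%N.
    apply: (commutes_of_Psi cj (BA _ q1) (AM _ q1)) => // s w Bw.
    exact: (Psi_A1P (BA _ q1) cj).
  have k2 : (2 <= k <= q)%N by lia.
  by have [] := AC k k2 u (BA k kq u Bu).
split=> [u [Bu uCr BuCr ueq]|lam v C lamCr vCr CCr vQ reg coef].
  pose v x := B (u x) - Qk (A 1%N) J (B (u x)).
  pose C x : 'cV[R]_(jdim J) := \col_s Gam (A 1%N) s (u x).
  pose lam (i : 'I_n) x := gam_bas J i (u x).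
  have vCr : Cr r Om v.
    apply: (Cr_clinear Om_open (T := fun y => y - Qk (A 1%N) J y)) => //.
    have -> : (fun y => y - Qk (A 1%N) J y) =
        fun y => idfun y + (-1) *: Qk (A 1%N) J y.
      by apply/funext => y; rewrite scaleN1r.
    apply: clinear_add; first exact: clinear_id.
    by apply: clinear_scale; exact: Q_clinear cj.
  have CCr : Cr r Om C.
    apply: (Cr_clinear Om_open
      (T := fun y => \col_s Gam (A 1%N) s y : 'cV[R]_(jdim J))) => //.
    apply: clinear_col => s; exact: (Gam_clinear cj).
  have lamCr (i : 'I_n) : (m <= i)%N -> Cr r Om (lam i).
    by move=> mi; apply: Cr_clinear => //; exact: (gam_bas_clinear cj).
  have vQ x : Om x -> coQk_range (A 1%N) J (v x) by move=> _; exists (B (u x)).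
  have uE x : Om x -> u x = assembled Bp v C lam x.
    move=> Ox.
    rewrite {1}(pseudoinverse_decomposition cj mn Bp_inv BM (Bu x Ox)).
    rewrite /assembled PE; congr (_ + _ + _).
    by apply: eq_bigr => s _; rewrite mxE.
  have eqA x : Om x -> pdo_app (L 0%N) (fun z => B (assembled Bp v C lam z)) x
      + \sum_(1 <= k < q.+1)
          pdo_app (L k) (fun z => A k (assembled Bp v C lam z)) x = f x.
    move=> Ox; rewrite -ueq//; congr (_ + _).
      by apply: (eq_pdo_app Om_open) => // y Oy; rewrite -uE.
    apply: eq_bigr => k _.
    by apply: (eq_pdo_app Om_open) => // y Oy; rewrite -uE.
  have eqns x (Ox : Om x) := (equation_splits cj mn noeth Om_open
    Bp_inv Lk BA ACk BM AM vCr CCr lamCr vQ (f x) Ox).1 (eqA x Ox).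
  by exists v, C, lam; split=> // x Ox; have [] := eqns x Ox.
split.
- by move=> x _; exact: (dom_assembled cj mn noeth Bp_inv).
- exact: (assembled_Cr Om_open Bp_inv).
- exact: (B_assembled_Cr cj mn noeth Om_open Bp_inv BM).
- move=> x Ox; apply/(equation_splits cj mn noeth Om_open
    Bp_inv Lk BA ACk BM AM vCr CCr lamCr vQ (f x) Ox).
  by split; [exact: reg|exact: coef].
Qed.
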